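(* The compact simple Lie group $\mathrm{Sp}(4)$ admits non-naturally reductive left-invariant Einstein metrics which are $\mathrm{Ad}(4\,\mathrm{Sp}(1))$-invariant, where $4\,\mathrm{Sp}(1)=\mathrm{Sp}(1)\times\mathrm{Sp}(1)\times\mathrm{Sp}(1)\times\mathrm{Sp}(1)$ is embedded in $\mathrm{Sp}(4)$ as the subgroup of diagonal matrices.
   Context: $\mathrm{Sp}(n)$ is the compact symplectic group, i.e. the group of $n\times n$ quaternionic matrices $A$ with $A^*A=I$, and $\mathfrak{sp}(n)$ is its Lie algebra. A left-invariant Riemannian metric on a Lie group $G$ is identified with an inner product on its Lie algebra $\mathfrak g$; for a closed subgroup $H\subset G$ it is called $\mathrm{Ad}(H)$-invariant if this inner product is invariant under $\mathrm{Ad}(h)$ for every $h\in H$. A Riemannian metric $g$ is Einstein if its Ricci tensor $r$ satisfies $r=\lambda g$ for some constant $\lambda\in\mathbb R$. Naturally reductive left-invariant metrics: let $G$ be a compact simple Lie group with Lie algebra $\mathfrak g$, and let $B$ be the negative of the Killing form of $\mathfrak g$. A left-invariant metric $\langle\cdot,\cdot\rangle$ on $G$ is naturally reductive if there is a closed subgroup $K$ of $G$ such that it is naturally reductive as a homogeneous metric with respect to the action $(g,k)\cdot y=gyk^{-1}$ of $G\times K$ on $G$. By a theorem of D'Atri and Ziller, this is equivalent to the existence of a closed subgroup $K$ of $G$, with Lie algebra $\mathfrak k=\mathfrak k_0\oplus\mathfrak k_1\oplus\cdots\oplus\mathfrak k_p$ ($\mathfrak k_0$ the center of $\mathfrak k$,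 and $\mathfrak k_1,\dots,\mathfrak k_p$ the simple ideals of $\mathfrak k$) and $B$-orthogonal complement $\mathfrak m$ in $\mathfrak g$, such that $$\langle\cdot,\cdot\rangle=u_0\,b|_{\mathfrak k_0}+u_1B|_{\mathfrak k_1}+\cdots+u_pB|_{\mathfrak k_p}+xB|_{\mathfrak m}$$ for some inner product $b$ on $\mathfrak k_0$ and some positive reals $u_0,\dots,u_p,x$. A left-invariant metric is non-naturally reductive if it is not naturally reductive. *)

(* Defs.v *)
From HB Require Import structures.
From mathcomp Require Import all_boot all_order all_algebra ring.
From mathcomp Require Import all_classical all_reals all_analysis.
Import Order.TTheory GRing.Theory Num.Theory.
Import numFieldNormedType.Exports.

Set Implicit Arguments.
Unset Strict Implicit.
Unset Printing Implicit Defensive.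

Local Open Scope classical_set_scope.
Local Open Scope ring_scope.

(* Quat a b c d is a + b i + c j + d k. *)
Record quat (R : Type) := Quat { q_re : R; q_i : R; q_j : R; q_k : R }.

Section QuatRing.
Variable R : realType.
Implicit Types p q : quat R.

Definition quat_tuple q := (q_re q, q_i q, q_j q, q_k q).
Definition tuple_quat (t : R * R * R * R) :=
  let: (a, b, c, d) := t in Quat a b c d.
Lemma quat_tupleK : cancel quat_tuple tuple_quat. Proof. by case. Qed.
HB.instance Definition _ := Choice.copy (quat R) (can_type quat_tupleK).

Definition quat_add p q :=
  Quat (q_re p + q_re q) (q_i p + q_i q) (q_j p + q_j q) (q_k p + q_k q).
Definition quat_opp p := Quat (- q_re p) (- q_i p) (- q_j p) (- q_k p).
Definition quat_mul p q :=
  Quat (q_re p * q_re q - q_i p * q_i q - q_j p * q_j q - q_k p * q_k q)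
       (q_re p * q_i q + q_i p * q_re q + q_j p * q_k q - q_k p * q_j q)
       (q_re p * q_j q - q_i p * q_k q + q_j p * q_re q + q_k p * q_i q)
       (q_re p * q_k q + q_i p * q_j q - q_j p * q_i q + q_k p * q_re q).
Definition quat_real (a : R) := Quat a 0 0 0.

Lemma quat_addA : associative quat_add.
Proof. by move=> [? ? ? ?] [? ? ? ?] [? ? ? ?]; congr Quat; exact: addrA. Qed.
Lemma quat_addC : commutative quat_add.
Proof. by move=> [? ? ? ?] [? ? ? ?]; congr Quat; exact: addrC. Qed.
Lemma quat_add0 : left_id (quat_real 0) quat_add.
Proof. by move=> [? ? ? ?]; congr Quat; exact: add0r. Qed.
Lemma quat_addN : left_inverse (quat_real 0) quat_opp quat_add.
Proof. by move=> [? ? ? ?]; congr Quat; exact: addNr. Qed.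
HB.instance Definition _ :=
  GRing.isZmodule.Build (quat R) quat_addA quat_addC quat_add0 quat_addN.

Lemma quat_mulA : associative quat_mul.
Proof. by move=> [? ? ? ?] [? ? ? ?] [? ? ? ?]; congr Quat => /=; ring. Qed.
Lemma quat_mul1l : left_id (quat_real 1) quat_mul.
Proof. by move=> [? ? ? ?]; congr Quat => /=; ring. Qed.
Lemma quat_mul1r : right_id (quat_real 1) quat_mul.
Proof. by move=> [? ? ? ?]; congr Quat => /=; ring. Qed.
Lemma quat_mulDl : left_distributive quat_mul quat_add.
Proof. by move=> [? ? ? ?] [? ? ? ?] [? ? ? ?]; congr Quat => /=; ring. Qed.
Lemma quat_mulDr : right_distributive quat_mul quat_add.
Proof. by move=> [? ? ? ?] [? ? ? ?] [? ? ? ?]; congr Quat => /=; ring. Qed.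
Lemma quat_one_neq0 : quat_real 1 != 0.
Proof. by apply/eqP => -[] /eqP; rewrite oner_eq0. Qed.
HB.instance Definition _ := GRing.Zmodule_isNzRing.Build (quat R)
  quat_mulA quat_mul1l quat_mul1r quat_mulDl quat_mulDr quat_one_neq0.

Definition quat_conj q := Quat (q_re q) (- q_i q) (- q_j q) (- q_k q).

Lemma quat_conjD p q : quat_conj (p + q) = quat_conj p + quat_conj q.
Proof. by congr Quat => /=; rewrite ?opprD. Qed.
Lemma quat_conjM p q : quat_conj (p * q) = quat_conj q * quat_conj p.
Proof. by case: p q => [? ? ? ?] [? ? ? ?]; congr Quat => /=; ring. Qed.
Lemma quat_conj0 : quat_conj 0 = 0.
Proof. by congr Quat; rewrite oppr0. Qed.
Lemma quat_conjK : involutive quat_conj.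
Proof. by case=> *; congr Quat => /=; rewrite opprK. Qed.

End QuatRing.

(* An alias of 'M[quat R]_n on which *: is scaling by real numbers; on
   'M[quat R]_n itself it is left multiplication by quaternions. *)
Definition qmx (R : realType) (n : nat) := 'M[quat R]_n.

Section QuatMatrices.
Import VectorInternalTheory.
Variables (R : realType) (n : nat).
Implicit Types A B : qmx R n.

HB.instance Definition _ := Choice.on (qmx R n).
HB.instance Definition _ := GRing.Zmodule.on (qmx R n).

Definition qmx_scale (a : R) A : qmx R n :=
  \matrix_(i, j) (quat_real a * A i j).

Lemma qmx_scaleA a b A : qmx_scale a (qmx_scale b A) = qmx_scale (a * b) A.
Proof.
apply/matrixP => i j; rewrite !mxE mulrA; congr (_ * _).
by congr Quat => /=; ring.
Qed.
Lemma qmx_scale1 : left_id 1 qmx_scale.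
Proof. by move=> A; apply/matrixP => i j; rewrite !mxE [LHS]mul1r. Qed.
Lemma qmx_scaleDr : right_distributive qmx_scale +%R.
Proof. by move=> a A B; apply/matrixP => i j; rewrite !mxE mulrDr. Qed.
Lemma qmx_scaleDl A : {morph qmx_scale^~ A : a b / a + b}.
Proof.
move=> a b; apply/matrixP => i j; rewrite !mxE -mulrDl; congr (_ * _).
by congr Quat => /=; ring.
Qed.
HB.instance Definition _ := GRing.Zmodule_isLmodule.Build R (qmx R n)
  qmx_scaleA qmx_scale1 qmx_scaleDr qmx_scaleDl.

Definition qmx_coords A : 'M[R]_n * 'M[R]_n * 'M[R]_n * 'M[R]_n :=
  (map_mx (@q_re R) A, map_mx (@q_i R) A,
   map_mx (@q_j R) A, map_mx (@q_k R) A).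
Definition coords_qmx (T : 'M[R]_n * 'M[R]_n * 'M[R]_n * 'M[R]_n) : qmx R n :=
  let: (M0, M1, M2, M3) := T in
  \matrix_(i, j) Quat (M0 i j) (M1 i j) (M2 i j) (M3 i j).

Lemma qmx_coordsK : cancel qmx_coords coords_qmx.
Proof. by move=> A; apply/matrixP => i j; rewrite !mxE; case: (A i j). Qed.
Lemma coords_qmxK : cancel coords_qmx qmx_coords.
Proof.
by move=> [[[M0 M1] M2] M3]; congr (_, _, _, _); apply/matrixP => i j;
  rewrite !mxE.
Qed.
Lemma qmx_coords_is_linear : linear qmx_coords.
Proof.
by move=> a A B; congr (_, _, _, _); apply/matrixP => i j; rewrite !mxE /=;
  ring.
Qed.
HB.instance Definition _ :=
  GRing.isLinear.Build R (qmx R n) _ _ qmx_coords qmx_coords_is_linear.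

Lemma qmx_vect_iso :
  Vector.axiom (dim ('M[R]_n * 'M[R]_n * 'M[R]_n * 'M[R]_n)%type) (qmx R n).
Proof.
exists (v2r \o qmx_coords).
  by move=> a A B; rewrite /= qmx_coords_is_linear; exact: linearP.
exists (coords_qmx \o r2v) => A /=.
  by rewrite v2rK qmx_coordsK.
by rewrite coords_qmxK r2vK.
Qed.
HB.instance Definition _ := Lmodule_hasFinDim.Build R (qmx R n) qmx_vect_iso.

Lemma qmulmxN A B : A *m (- B : qmx R n) = - (A *m B : qmx R n).
Proof. exact: mulmxN. Qed.
Lemma qmulNmx A B : (- A : qmx R n) *m B = - (A *m B : qmx R n).
Proof. exact: mulNmx. Qed.

Definition qadj A : qmx R n := (map_mx (@quat_conj R) A)^T.

Lemma qadjM A B : qadj (A *m B) = qadj B *m qadj A.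
Proof.
apply/matrixP => i j; rewrite !mxE.
have -> : quat_conj (\sum_k A j k * B k i) =
          \sum_k quat_conj (A j k * B k i).
  exact: (big_morph _ (@quat_conjD R) (quat_conj0 R)).
by apply: eq_bigr => k _; rewrite !mxE quat_conjM.
Qed.
Lemma qadjK : involutive qadj.
Proof. by move=> A; apply/matrixP => i j; rewrite !mxE quat_conjK. Qed.
Lemma qadj_is_linear : linear qadj.
Proof.
by move=> a A B; apply/matrixP => i j; rewrite !mxE; congr Quat => /=; ring.
Qed.
HB.instance Definition _ :=
  GRing.isLinear.Build R (qmx R n) (qmx R n) _ qadj qadj_is_linear.

End QuatMatrices.

Definition Sp (R : realType) (n : nat) : set (qmx R n) :=
  [set A | qadj A *m A = 1%:M].
Arguments Sp : clear implicits.

Definition add_qadj (R : realType) (n : nat) (A : qmx R n) : qmx R n :=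
  A + qadj A.

Lemma add_qadj_is_linear (R : realType) (n : nat) : linear (@add_qadj R n).
Proof.
by move=> a A B; rewrite /add_qadj linearP /= scalerDr addrACA.
Qed.
HB.instance Definition _ (R : realType) (n : nat) :=
  GRing.isLinear.Build R (qmx R n) (qmx R n) _ (@add_qadj R n)
    (@add_qadj_is_linear R n).

Definition sp_space (R : realType) (n : nat) : {vspace qmx R n} :=
  lker (linfun (@add_qadj R n)).

Lemma mem_sp_space (R : realType) (n : nat) (A : qmx R n) :
  (A \in sp_space R n) = (qadj A == - A).
Proof. by rewrite memv_ker lfunE /= /add_qadj addrC addr_eq0. Qed.

Notation sp R n := (subvs_of (sp_space R n)).

Section SpLie.
Variables (R : realType) (n : nat).
Implicit Types X Y : sp R n.

(* vsproj only repackages the bracket, which already lies in sp(n): see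
   vsval_sp_bracket. The same holds for spAd, see vsval_spAd. *)
Definition sp_bracket X Y : sp R n :=
  vsproj (sp_space R n) (vsval X *m vsval Y - vsval Y *m vsval X).

Lemma vsval_sp_bracket X Y :
  vsval (sp_bracket X Y) = vsval X *m vsval Y - vsval Y *m vsval X.
Proof.
rewrite vsprojK // mem_sp_space linearB /= !qadjM.
have:= subvsP X; have:= subvsP Y; rewrite !mem_sp_space => /eqP-> /eqP->.
by rewrite !qmulmxN !qmulNmx !opprK opprB.
Qed.

(* For h in Sp(n) the inverse of h is its adjoint. *)
Definition spAd (h : qmx R n) X : sp R n :=
  vsproj (sp_space R n) (h *m vsval X *m qadj h).

Lemma vsval_spAd h X : vsval (spAd h X) = h *m vsval X *m qadj h.
Proof.
rewrite vsprojK // mem_sp_space !qadjM qadjK.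
have:= subvsP X; rewrite mem_sp_space => /eqP->.
by rewrite qmulNmx qmulmxN mulmxA.
Qed.

(* The topology and the differential calculus of qmx R n = R^(4 n^2) are those
   of the normed space 'M[R]_n * 'M[R]_n * 'M[R]_n * 'M[R]_n, through the linear
   isomorphism qmx_coords. *)
Record closed_subgroup (K : set (qmx R n)) : Prop := ClosedSubgroup {
  closed_subgroup_sub : K `<=` Sp R n;
  closed_subgroup1 : K 1%:M;
  closed_subgroupM : forall A B, K A -> K B -> K (A *m B);
  closed_subgroupV : forall A, K A -> K (qadj A);
  closed_subgroup_closed : closed [set qmx_coords A | A in K]
}.

(* The subspace k is the Lie algebra of K: it consists of the velocities at 0
   of the one-parameter subgroups t |-> exp(tX) contained in K. *)
Definition is_lie_algebra_of (K : set (qmx R n)) (k : {vspace sp R n}) : Prop :=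
  forall X, X \in k <->
    exists gamma : R -> qmx R n,
      [/\ forall t, K (gamma t),
          forall s t, gamma (s + t) = gamma s *m gamma t &
          is_derive (0 : R) (1 : R) (fun t => qmx_coords (gamma t))
            (qmx_coords (vsval X))].

End SpLie.
Arguments sp_bracket : clear implicits.

Notation inner_product V := {dot V for idfun}.

Section LeftInvariant.
Variables (R : realType) (V : vectType R) (br : V -> V -> V).

Definition vtrace (f : V -> V) : R :=
  \sum_(i < \dim {:V}) coord (vbasis {:V}) i (f (vbasis {:V})`_i).

(* Elements of V are left-invariant vector fields, so the functions g Y Z are
   constant and metric compatibility reads g (D_X Y) Z + g Y (D_X Z) = 0.
   The two conditions determine D (see levi_civita_koszul); in particular
   D is bilinear. *)
Definition levi_civita (g : inner_product V) (D : V -> V -> V) : Prop :=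
  (forall X Y, D X Y - D Y X = br X Y) /\
  (forall X Y Z, g (D X Y) Z + g Y (D X Z) = 0).

Lemma levi_civita_koszul (g : inner_product V) D : levi_civita g D ->
  forall X Y Z, 2 * g (D X Y) Z = g (br X Y) Z - g (br Y Z) X + g (br Z X) Y.
Proof.
move=> [tor met] X Y Z; rewrite -!tor !linearBl /=.
have sym U W : g U W = g W U by rewrite hermC /= expr0 mul1r.
have := met X Y Z; have := met Y Z X; have := met Z X Y.
rewrite ![g X (D _ _)]sym ![g Y (D _ _)]sym ![g Z (D _ _)]sym.
by move=> /eqP; rewrite addr_eq0 => /eqP-> /eqP;
   rewrite addr_eq0 => /eqP-> /eqP; rewrite addrC addr_eq0 => /eqP->; ring.
Qed.

Definition curvature (D : V -> V -> V) (X Y Z : V) : V :=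
  D X (D Y Z) - D Y (D X Z) - D (br X Y) Z.

Definition ricci (D : V -> V -> V) (Y Z : V) : R :=
  vtrace (fun X => curvature D X Y Z).

Definition einstein (g : inner_product V) : Prop :=
  exists2 D, levi_civita g D &
    exists lambda : R, forall Y Z, ricci D Y Z = lambda * g Y Z.

End LeftInvariant.

Section NaturallyReductive.
Variables (R : realType) (n : nat).

Definition Ad_invariant (H : set (qmx R n)) (g : inner_product (sp R n)) :=
  forall h, H h -> forall X Y, g (spAd h X) (spAd h Y) = g X Y.

Definition pair_bracket (U W : sp R n * sp R n) : sp R n * sp R n :=
  (sp_bracket R n U.1 W.1, sp_bracket R n U.2 W.2).

(* Differential at the identity of the orbit map (a, k) |-> a k^-1 of the
   identity element, for the action (a, k) . y = a y k^-1. *)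
Definition orbit_diff (U : sp R n * sp R n) : sp R n := U.1 - U.2.

Definition diag_pair (X : sp R n) : sp R n * sp R n := (X, X).

Lemma diag_pair_is_linear : linear diag_pair. Proof. by []. Qed.
HB.instance Definition _ :=
  GRing.isLinear.Build R (sp R n) (sp R n * sp R n)%type _ diag_pair
    diag_pair_is_linear.

(* The Lie algebra sp(n) + k of Sp(n) x K. *)
Definition prod_alg (k : {vspace sp R n}) : {vspace sp R n * sp R n} :=
  (linfun snd @^-1: k)%VS.

(* The Lie algebra of the isotropy group {(h, h) | h in K} of the identity. *)
Definition isotropy_alg (k : {vspace sp R n}) : {vspace sp R n * sp R n} :=
  (linfun diag_pair @: k)%VS.

(* G = Sp(n) is the homogeneous space (G x K) / {(h, h) | h in K}. The metric
   is invariant under G x K iff it is Ad(K)-invariant. The last three clauses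
   give a reductive complement p of the isotropy algebra, identified with
   T_1 G through orbit_diff, and the condition
     <[X, Y]_p, Z> + <Y, [X, Z]_p> = 0   for X, Y, Z in p,
   where daddv_pi p h is the projection onto p along h. *)
Definition naturally_reductive_wrt (K : set (qmx R n)) (k : {vspace sp R n})
    (g : inner_product (sp R n)) : Prop :=
  Ad_invariant K g /\
  exists p : {vspace sp R n * sp R n},
    let h := isotropy_alg k in
    let gp U W := g (orbit_diff U) (orbit_diff W) in
    [/\ (p :&: h = 0)%VS /\ (p + h = prod_alg k)%VS,
        forall a, K a -> forall U, U \in p -> (spAd a U.1, spAd a U.2) \in p &
        forall X Y Z, X \in p -> Y \in p -> Z \in p ->
          gp (daddv_pi p h (pair_bracket X Y)) Z +
          gp Y (daddv_pi p h (pair_bracket X Z)) = 0].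

Definition naturally_reductive (g : inner_product (sp R n)) : Prop :=
  exists (K : set (qmx R n)) (k : {vspace sp R n}),
    [/\ closed_subgroup K, is_lie_algebra_of K k &
        naturally_reductive_wrt K k g].

(* The diagonal matrices in Sp(n): n copies of Sp(1). *)
Definition diag_Sp1 : set (qmx R n) :=
  [set A | Sp R n A /\ is_diag_mx (A : 'M[quat R]_n)].

End NaturallyReductive.
Arguments diag_Sp1 : clear implicits.

(* Main.v *)
(* Write X in sp(4) as a quaternionic matrix (X_ij). The Ad(4 Sp(1))-invariant
   metrics are <X, Y> = sum_ij lam_ij Re(X_ij conj(Y_ij)), lam symmetric. Their
   Levi-Civita connection is
     (D_X Y)_rs = sum_k P_rks X_rk Y_ks - P_skr Y_rk X_ks,
     P_rks = (1 + (lam_ks - lam_rk) / lam_rs) / 2,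
   and Ric(Y, Z) = - tr (X |-> D_(D_X Y) Z) turns the Einstein condition into
     4 sum_i P_ikj P_ijk + P_jjk + P_kkj = c lam_jk.
   Take lam_00 = v, and lam_0i = 1, lam_ii = u, lam_ij = x for distinct
   i, j > 0. Elimination leaves, besides the naturally reductive
   branch u = x, u = 2x / (x^2 + 5) and a polynomial equation in x which has a
   root between 3/2 and 8/5.

   If such a metric is naturally reductive with respect to K, the Lie algebra
   k of K acts by skew derivations, hence consists of diagonal matrices since
   u differs from 1 and x. The reductive complement is a graph
   {(X + C X, C X)} with C X in k, and natural reductivity evaluated at
   elements with entries at (0,2), (2,1) and (0,1) forces lam_01 = lam_21,
   that is x = 1. *)

From HB Require Import structures.
Require Import Defs.
From mathcomp Require Import all_boot all_order all_algebra ring lra.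
From mathcomp Require Import all_classical all_reals all_analysis.
Import Order.TTheory GRing.Theory Num.Theory.
Import numFieldNormedType.Exports.

Set Implicit Arguments.
Unset Strict Implicit.
Unset Printing Implicit Defensive.

Local Open Scope classical_set_scope.
Local Open Scope ring_scope.

(** * Traces of endomorphisms *)

Section Trace.
Variables (R : realType) (V : vectType R).
Implicit Types f g : V -> V.

Lemma vtraceB f g : vtrace (fun X => f X - g X) = vtrace f - vtrace g.
Proof. by rewrite -sumrB; apply: eq_bigr => i _; rewrite linearB. Qed.

(** The expansion makes [f] the sum of the rank-one maps X |-> phi_a(X) f(e_a), whose traces are
    phi_a(f(e_a)). The vectors e_a may be linearly dependent, and they are in the application to
    sp(n). *)
Lemma vtrace_frame (I : finType) (e : I -> V) (phi : I -> V -> R) f :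
  linear f -> (forall a, scalar (phi a)) ->
  (forall X, X = \sum_a phi a X *: e a) -> vtrace f = \sum_a phi a (f (e a)).
Proof.
move=> lf lphi frame.
pose fL := HB.pack_for {linear V -> V} f (GRing.isLinear.Build _ _ _ _ f lf).
pose pL a := HB.pack_for {scalar V} (phi a)
  (GRing.isLinear.Build _ _ _ _ (phi a) (lphi a)).
have fE X : f X = fL X by [].
have pE a X : phi a X = pL a X by [].
transitivity (\sum_(i < \dim {:V}) \sum_a phi a (vbasis {:V})`_i *
    coord (vbasis {:V}) i (f (e a))).
  apply: eq_bigr => i _; rewrite [in LHS](frame (vbasis _)`_i) fE !linear_sum.
  by apply: eq_bigr => a _; rewrite !linearZ.
rewrite exchange_big; apply: eq_bigr => a _ /=.
rewrite [in RHS](coord_vbasis (memvf (f (e a)))) pE linear_sum.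
by apply: eq_bigr => i _; rewrite linearZ /= mulrC.
Qed.

Lemma vtraceC f g : linear f -> linear g -> vtrace (f \o g) = vtrace (g \o f).
Proof.
move=> lf lg.
have comp h k : linear h -> vtrace (h \o k) =
    \sum_(i < \dim {:V}) \sum_(j < \dim {:V})
      coord (vbasis {:V}) j (k (vbasis {:V})`_i) *
      coord (vbasis {:V}) i (h (vbasis {:V})`_j).
  move=> lh; pose hL := HB.pack_for {linear V -> V} h
    (GRing.isLinear.Build _ _ _ _ h lh).
  apply: eq_bigr => i _ /=; rewrite (coord_vbasis (memvf (k _))).
  rewrite -[h]/(hL : V -> V) !linear_sum; apply: eq_bigr => j _.
  by rewrite !linearZ -coord_vbasis ?memvf.
rewrite !comp // exchange_big; apply: eq_bigr => i _.
by apply: eq_bigr => j _; rewrite mulrC.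
Qed.

End Trace.

(** * The Ricci tensor as a single trace *)

Section Ricci.
Variables (R : realType) (V : vectType R) (br : V -> V -> V).
Variables (g : inner_product V) (D : V -> V -> V).
Hypothesis D_lc : levi_civita br g D.
Hypothesis D_linl : forall Y, linear (D ^~ Y).
Hypothesis D_linr : forall X, linear (D X).
Hypothesis D_trace : forall Y, vtrace (D ^~ Y) = 0.

(* tr (X |-> D_X W) vanishes and, D being torsion free, the two terms
   D_Y (D_X Z) and D_(D_Y X) Z have the same trace by cyclicity. *)
Lemma ricci_trace Y Z : ricci br D Y Z = - vtrace (fun X => D (D X Y) Z).
Proof.
have DB X U W : D (X - U) W = D X W - D U W.
  pose L := HB.pack_for {linear V -> V} (D ^~ W)
    (GRing.isLinear.Build _ _ _ _ (D ^~ W) (@D_linl W)).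
  exact: (linearB L).
rewrite /ricci /curvature.
under [X in vtrace X]eq_fun => X do rewrite -D_lc.1 DB.
rewrite !vtraceB D_trace.
have := vtraceC (@D_linr Y) (@D_linl Z); rewrite /comp => ->.
by ring.
Qed.

End Ricci.

(** * Diagonal metrics and their Levi-Civita connection *)

Section Quaternions.
Variable R : realType.
Implicit Types p q : quat R.

Lemma quat_ext p q : q_re p = q_re q -> q_i p = q_i q ->
  q_j p = q_j q -> q_k p = q_k q -> p = q.
Proof. by case: p q => [? ? ? ?] [? ? ? ?] /= -> -> -> ->. Qed.

Lemma q_reD p q : q_re (p + q) = q_re p + q_re q. Proof. by []. Qed.
Lemma q_iD p q : q_i (p + q) = q_i p + q_i q. Proof. by []. Qed.
Lemma q_jD p q : q_j (p + q) = q_j p + q_j q. Proof. by []. Qed.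
Lemma q_kD p q : q_k (p + q) = q_k p + q_k q. Proof. by []. Qed.
Lemma q_reN p : q_re (- p) = - q_re p. Proof. by []. Qed.
Lemma q_iN p : q_i (- p) = - q_i p. Proof. by []. Qed.
Lemma q_jN p : q_j (- p) = - q_j p. Proof. by []. Qed.
Lemma q_kN p : q_k (- p) = - q_k p. Proof. by []. Qed.
Lemma q_re0 : q_re (0 : quat R) = 0. Proof. by []. Qed.
Lemma q_i0 : q_i (0 : quat R) = 0. Proof. by []. Qed.
Lemma q_j0 : q_j (0 : quat R) = 0. Proof. by []. Qed.
Lemma q_k0 : q_k (0 : quat R) = 0. Proof. by []. Qed.
Lemma q_re1 : q_re (1 : quat R) = 1. Proof. by []. Qed.
Lemma q_i1 : q_i (1 : quat R) = 0. Proof. by []. Qed.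
Lemma q_j1 : q_j (1 : quat R) = 0. Proof. by []. Qed.
Lemma q_k1 : q_k (1 : quat R) = 0. Proof. by []. Qed.
Lemma q_reM p q : q_re (p * q) =
  q_re p * q_re q - q_i p * q_i q - q_j p * q_j q - q_k p * q_k q.
Proof. by []. Qed.
Lemma q_iM p q : q_i (p * q) =
  q_re p * q_i q + q_i p * q_re q + q_j p * q_k q - q_k p * q_j q.
Proof. by []. Qed.
Lemma q_jM p q : q_j (p * q) =
  q_re p * q_j q - q_i p * q_k q + q_j p * q_re q + q_k p * q_i q.
Proof. by []. Qed.
Lemma q_kM p q : q_k (p * q) =
  q_re p * q_k q + q_i p * q_j q - q_j p * q_i q + q_k p * q_re q.
Proof. by []. Qed.
Lemma q_re_conj q : q_re (quat_conj q) = q_re q. Proof. by []. Qed.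
Lemma q_i_conj q : q_i (quat_conj q) = - q_i q. Proof. by []. Qed.
Lemma q_j_conj q : q_j (quat_conj q) = - q_j q. Proof. by []. Qed.
Lemma q_k_conj q : q_k (quat_conj q) = - q_k q. Proof. by []. Qed.
Lemma q_re_real (a : R) : q_re (quat_real a) = a. Proof. by []. Qed.
Lemma q_i_real (a : R) : q_i (quat_real a) = 0. Proof. by []. Qed.
Lemma q_j_real (a : R) : q_j (quat_real a) = 0. Proof. by []. Qed.
Lemma q_k_real (a : R) : q_k (quat_real a) = 0. Proof. by []. Qed.

Definition quatE := (q_reD, q_iD, q_jD, q_kD, q_reN, q_iN, q_jN, q_kN,
  q_re0, q_i0, q_j0, q_k0, q_re1, q_i1, q_j1, q_k1, q_reM, q_iM, q_jM, q_kM,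
  q_re_conj, q_i_conj, q_j_conj, q_k_conj,
  q_re_real, q_i_real, q_j_real, q_k_real).

Lemma q_re_sum (I : Type) (r : seq I) (P : pred I) (F : I -> quat R) :
  q_re (\sum_(i <- r | P i) F i) = \sum_(i <- r | P i) q_re (F i).
Proof. exact: (big_morph (@q_re R) q_reD q_re0). Qed.

Definition qdot p q : R :=
  q_re p * q_re q + q_i p * q_i q + q_j p * q_j q + q_k p * q_k q.

Lemma qdotE p q : qdot p q = q_re (p * quat_conj q).
Proof. by rewrite /qdot !quatE; ring. Qed.

Lemma qdotC p q : qdot p q = qdot q p.
Proof. by rewrite /qdot; ring. Qed.

Lemma qdot_ge0 p : 0 <= qdot p p.
Proof. by rewrite /qdot -!expr2 !addr_ge0 ?sqr_ge0. Qed.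

Lemma qdot_eq0 p : qdot p p = 0 -> p = 0.
Proof.
case: p => a b c d; rewrite /qdot /= -!expr2 => /eqP.
rewrite paddr_eq0 ?addr_ge0 ?sqr_ge0 // => /andP[].
rewrite paddr_eq0 ?addr_ge0 ?sqr_ge0 // => /andP[].
rewrite paddr_eq0 ?addr_ge0 ?sqr_ge0 // => /andP[].
by rewrite !sqrf_eq0 => /eqP-> /eqP-> /eqP-> /eqP->.
Qed.

Lemma q_reMC p q : q_re (p * q) = q_re (q * p).
Proof. by rewrite !quatE; ring. Qed.

Lemma quat_real_false : quat_real (false%:R : R) = 0. Proof. by []. Qed.
Lemma quat_real_true : quat_real (true%:R : R) = 1. Proof. by []. Qed.

Lemma quat_realM (a b : R) : quat_real a * quat_real b = quat_real (a * b).
Proof. by apply: quat_ext; rewrite !quatE; ring. Qed.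

Lemma quat_realC (a : R) q : quat_real a * q = q * quat_real a.
Proof. by apply: quat_ext; rewrite !quatE; ring. Qed.

Lemma quat_realCA (a b : R) q :
  quat_real a * (quat_real b * q) = quat_real b * (quat_real a * q).
Proof. by rewrite !mulrA [quat_real a * _]quat_realC. Qed.

(** For real-linear [T] this is its trace on the real space of quaternions, in the basis 1, i, j,
    k. *)
Definition qtr (T : quat R -> quat R) : R :=
  q_re (T (Quat 1 0 0 0)) + q_i (T (Quat 0 1 0 0)) +
  q_j (T (Quat 0 0 1 0)) + q_k (T (Quat 0 0 0 1)).

Lemma qtrD S T : qtr (fun q => S q + T q) = qtr S + qtr T.
Proof. by rewrite /qtr !quatE /=; ring. Qed.

Lemma qtrN T : qtr (fun q => - T q) = - qtr T.
Proof. by rewrite /qtr !quatE /=; ring. Qed.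

Lemma qtr_sum (I : Type) (r : seq I) (T : I -> quat R -> quat R) :
  qtr (fun q => \sum_(i <- r) T i q) = \sum_(i <- r) qtr (T i).
Proof.
elim: r => [|i r IH].
  by rewrite big_nil /qtr !big_nil !quatE; ring.
rewrite big_cons -IH -qtrD; congr qtr; apply/funext => q.
by rewrite big_cons.
Qed.

Lemma qtrZ a T : qtr (fun q => quat_real a * T q) = a * qtr T.
Proof. by rewrite /qtr !quatE /=; ring. Qed.

End Quaternions.

Section LeviCivita.
Variables (R : realType) (n : nat) (lam : 'I_n -> 'I_n -> R).
Hypothesis lam_gt0 : forall i j, 0 < lam i j.
Hypothesis lamC : forall i j, lam i j = lam j i.
Local Notation g := (sp R n).
Implicit Types X Y Z : g.

Lemma sp_entry X r s : vsval X s r = - quat_conj (vsval X r s).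
Proof.
have := subvsP X; rewrite mem_sp_space => /eqP /matrixP /(_ s r).
by rewrite !mxE => ->; rewrite opprK.
Qed.

Lemma sp_re_diag X r : q_re (vsval X r r) = 0.
Proof.
have /(congr1 (@q_re R)) := sp_entry X r r.
by rewrite !quatE /= => H; lra.
Qed.

Lemma sp_mem_entry (A : qmx R n) :
  (forall r s, A s r = - quat_conj (A r s)) -> A \in sp_space R n.
Proof.
move=> H; rewrite mem_sp_space; apply/eqP/matrixP => r s; rewrite !mxE.
by rewrite (H s r) opprK.
Qed.

Lemma sp_ext X Y : (forall r s, vsval X r s = vsval Y r s) -> X = Y.
Proof. by move=> H; apply/val_inj/matrixP. Qed.

Definition metric_fun X Y : R :=
  \sum_r \sum_s lam r s * qdot (vsval X r s) (vsval Y r s).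

Lemma metric_fun_is_bilinear :
  bilinear_for ( *%R) ((@idfun R) \; *%R) metric_fun.
Proof.
split=> [Y a X Z|X a Y Z]; rewrite /metric_fun /= mulr_sumr -big_split;
  apply: eq_bigr => r _ /=; rewrite mulr_sumr -big_split;
  apply: eq_bigr => s _ /=; rewrite /qdot !mxE !quatE; ring.
Qed.

Lemma metric_fun_hermitian X Y :
  metric_fun X Y = (-1) ^+ false * idfun (metric_fun Y X).
Proof.
rewrite /= expr0 mul1r; apply: eq_bigr => r _; apply: eq_bigr => s _.
by rewrite qdotC.
Qed.

Lemma metric_fun_gt0 X : X != 0 -> 0 < metric_fun X X.
Proof.
have ge0 r s : 0 <= lam r s * qdot (vsval X r s) (vsval X r s).
  by rewrite mulr_ge0 ?qdot_ge0 // ltW.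
rewrite lt_def sumr_ge0 ?andbT; last by move=> r _; apply: sumr_ge0.
apply: contra => /eqP H; apply/eqP/sp_ext => r s; rewrite linear0 mxE.
have H1 := psumr_eq0P (fun r _ => sumr_ge0 _ (fun s _ => ge0 r s)) H
  (i := r) isT.
have /eqP := psumr_eq0P (fun s _ => ge0 r s) H1 (i:=s) isT.
by rewrite mulf_eq0 gt_eqF //= => /eqP/qdot_eq0.
Qed.

Definition metric : inner_product g :=
  HB.pack_for (inner_product g) metric_fun
    (bilinear_isBilinear.Build R g g R _ _ metric_fun metric_fun_is_bilinear)
    (isHermitianSesquilinear.Build R g false idfun metric_fun
       metric_fun_hermitian)
    (isDotProduct.Build R g metric_fun metric_fun_gt0).

Lemma metricE X Y :
  metric X Y = \sum_r \sum_s lam r s * qdot (vsval X r s) (vsval Y r s).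
Proof. by []. Qed.

(** The weight that the Koszul formula gives to X_rk Y_ks in the entry (r, s) of D_X Y. For constant
    [lam] it is 1/2 and D_X Y is half the bracket, as for a bi-invariant metric. *)
Definition lc_coef r k s : R := (1 + (lam k s - lam r k) / lam r s) / 2.
Local Notation P := lc_coef.

Lemma lc_coefC r k s : P s k r = 1 - P r k s.
Proof.
have := gt_eqF (lam_gt0 r s).
rewrite /P [lam s r]lamC [lam k r]lamC [lam s k]lamC => /negbT lam0.
by field.
Qed.

Definition lc_mx X Y : qmx R n := \matrix_(r, s) \sum_k
  (quat_real (P r k s) * (vsval X r k * vsval Y k s)
   - quat_real (P s k r) * (vsval Y r k * vsval X k s)).

Definition lc X Y : g := vsproj (sp_space R n) (lc_mx X Y).

Lemma quat_conj_sum (I : Type) (s : seq I) (F : I -> quat R) :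
  quat_conj (\sum_(i <- s) F i) = \sum_(i <- s) quat_conj (F i).
Proof. exact: (big_morph _ (@quat_conjD R) (quat_conj0 R)). Qed.

(** Conjugation reverses products, so for skew-Hermitian X and Y exchanging r and s interchanges the
    two terms. Hence [lc_mx X Y] already lies in sp(n) and the projection leaves it unchanged. *)
Lemma lcE X Y r s : vsval (lc X Y) r s = \sum_k
  (quat_real (P r k s) * (vsval X r k * vsval Y k s)
   - quat_real (P s k r) * (vsval Y r k * vsval X k s)).
Proof.
rewrite /lc vsprojK ?mxE //; apply: sp_mem_entry => {}r {}s.
rewrite !mxE quat_conj_sum -sumrN; apply: eq_bigr => k _.
rewrite [vsval Y k r](sp_entry Y r k) [vsval X s k](sp_entry X k s).
rewrite [vsval X k r](sp_entry X r k) [vsval Y s k](sp_entry Y k s).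
move: (vsval X r k) (vsval X k s) (vsval Y r k) (vsval Y k s) => x x' y y'.
move: (P r k s) (P s k r) => p p'.
by apply: quat_ext; rewrite !quatE; ring.
Qed.

Lemma lc_linl Y : linear (lc ^~ Y).
Proof.
move=> a X Z; apply: sp_ext => r s; rewrite /= !mxE !lcE mulr_sumr.
rewrite -big_split; apply: eq_bigr => k _; rewrite /= !mxE.
rewrite mulrDl !mulrDr -[quat_real a * _ * _]mulrA.
rewrite [vsval Y r k * (quat_real a * _)]mulrA -quat_realC.
rewrite -[quat_real a * _ * vsval X k s]mulrA.
rewrite !(quat_realCA _ a) opprD addrACA mulrN.
by [].
Qed.

Lemma lc_linr X : linear (lc X).
Proof.
move=> a Y Z; apply: sp_ext => r s; rewrite /= !mxE !lcE mulr_sumr.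
rewrite -big_split; apply: eq_bigr => k _; rewrite /= !mxE.
rewrite mulrDl !mulrDr -[quat_real a * _ * _]mulrA.
rewrite [vsval X r k * (quat_real a * _)]mulrA -quat_realC.
rewrite -[quat_real a * _ * vsval Y k s]mulrA.
rewrite !(quat_realCA _ a) opprD addrACA mulrN.
by [].
Qed.

Lemma lc_torsion X Y : lc X Y - lc Y X = sp_bracket R n X Y.
Proof.
apply: sp_ext => r s; rewrite vsval_sp_bracket /= !mxE !lcE.
rewrite -!sumrB; apply: eq_bigr => k _; rewrite [P s k r]lc_coefC.
move: (vsval X r k) (vsval X k s) (vsval Y r k) (vsval Y k s) => x x' y y'.
move: (P r k s) => p.
by apply: quat_ext; rewrite !quatE; ring.
Qed.

(** The product <D_X Y, Z> is a difference of two sums over triangles r, k, s of real parts of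
    triple products. Their weights lam_rs P_rks = (lam_rs + lam_ks - lam_rk) / 2 are compatible with
    rotating the triangle, and Re is cyclic, so the four sums cancel in pairs. *)
Lemma lc_skew X Y Z : metric (lc X Y) Z + metric Y (lc X Z) = 0.
Proof.
pose t (U V W : g) := \sum_r \sum_s \sum_k lam r s * P r k s *
  q_re (vsval U r k * vsval V k s * vsval W s r) : R.
pose t' (U V W : g) := \sum_r \sum_s \sum_k lam r s * P s k r *
  q_re (vsval U r k * vsval V k s * vsval W s r) : R.
have gE U V W : metric (lc U V) W = t' V U W - t U V W.
  rewrite metricE /t /t' -sumrB; apply: eq_bigr => r _.
  rewrite -sumrB; apply: eq_bigr => s _.
  rewrite lcE qdotE -[quat_conj _]opprK -sp_entry mulrN q_reN.
  rewrite mulr_suml q_re_sum.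
  rewrite -sumrN mulr_sumr -sumrB; apply: eq_bigr => k _.
  move: (vsval U r k) (vsval V r k) (vsval U k s) (vsval V k s) (vsval W s r).
  move: (lam r s) (P r k s) (P s k r) => l p p' u v u' v' w.
  by rewrite !quatE; ring.
have rot U V W : t U V W = t' W U V.
  rewrite /t /t' exchange_big; apply: eq_bigr => s _.
  rewrite exchange_big; apply: eq_bigr => k _; apply: eq_bigr => r _.
  rewrite q_reMC mulrA; congr (_ * _).
  have /negbT := gt_eqF (lam_gt0 r s); have /negbT := gt_eqF (lam_gt0 s k).
  rewrite /P [lam k s]lamC [lam k r]lamC => H1 H2.
  by field; rewrite H1 H2.
have metricC U V : metric U V = metric V U.
  by rewrite hermC /= expr0 mul1r.
by rewrite [metric Y _]metricC !gE !rot; ring.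
Qed.

Lemma lc_levi_civita : levi_civita (sp_bracket R n) metric lc.
Proof. by split; [exact: lc_torsion | exact: lc_skew]. Qed.

End LeviCivita.

(** * Ricci curvature *)

Section Frame.
Variables (R : realType) (n : nat).
Local Notation g := (sp R n).
Implicit Types X Y Z : g.

Lemma sum_delta (F : 'I_n -> R) j : \sum_k (k == j)%:R * F k = F j.
Proof.
rewrite (bigD1 j) //= eqxx mul1r big1 ?addr0 // => k /negbTE ->.
by rewrite mul0r.
Qed.

Lemma quat_sum_delta2 (a : R) (F : 'I_n -> 'I_n -> quat R) r s :
  \sum_i \sum_j quat_real ((r == i)%:R * ((s == j)%:R * a)) * F i j =
  quat_real a * F r s.
Proof.
rewrite (bigD1 r) //= (bigD1 s) //= !eqxx !mul1r !big1 ?addr0 //.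
- move=> i /negbTE; rewrite eq_sym => ->; rewrite big1 // => j _.
  by rewrite mul0r [LHS]mul0r.
- by move=> j /negbTE; rewrite eq_sym => ->; rewrite mul0r mulr0 [LHS]mul0r.
Qed.

Lemma quat_sum_delta (a : 'I_n -> R) (F : 'I_n -> quat R) j :
  \sum_k quat_real ((k == j)%:R * a k) * F k = quat_real (a j) * F j.
Proof.
rewrite (bigD1 j) //= eqxx mul1r big1 ?addr0 // => k /negbTE ->.
by rewrite mul0r [LHS]mul0r.
Qed.

Lemma qtrB (T U : quat R -> quat R) :
  qtr (fun q => T q - U q) = qtr T - qtr U.
Proof. by rewrite qtrD qtrN. Qed.

Lemma qtr_mulr (p : quat R) : qtr (fun q => q * p) = 4 * q_re p.
Proof. by rewrite /qtr !quatE /=; ring. Qed.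

Lemma qtr_mull (p : quat R) : qtr (fun q => p * q) = 4 * q_re p.
Proof. by rewrite /qtr !quatE /=; ring. Qed.

(** For p = 1 this is the trace of conjugation, with eigenvalues 1, -1, -1, -1. *)
Lemma qtr_conjr (p : quat R) : qtr (fun q => quat_conj q * p) = - 2 * q_re p.
Proof. by rewrite /qtr !quatE /=; ring. Qed.

Lemma qtr_conjl (p : quat R) : qtr (fun q => p * quat_conj q) = - 2 * q_re p.
Proof. by rewrite /qtr !quatE /=; ring. Qed.

Lemma qtr_mid (p p' : quat R) :
  qtr (fun q => p * (q * p')) = 4 * (q_re p * q_re p').
Proof. by rewrite /qtr !quatE /=; ring. Qed.

Lemma qtr_conj_mid (p p' : quat R) :
  qtr (fun q => p * (quat_conj q * p')) = - 2 * q_re (p * quat_conj p').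
Proof. by rewrite /qtr !quatE /=; ring. Qed.

(** This and [qtr_framer] treat the two shapes of a summand in an entry of D_(D_F Z) Y for a frame
    element F: an entry of D_F Z multiplied by an entry [y] of Y from the right or from the left. *)
Lemma qtr_framel (a b c d e : R) (z1 z2 z3 z4 y : quat R) :
  qtr (fun q => quat_real e *
    ((quat_real a * (q * z1) - quat_real b * (z2 * q) -
      quat_real c * (quat_conj q * z3) + quat_real d * (z4 * quat_conj q)) * y))
  = e * (4 * a * q_re (z1 * y) - 4 * b * (q_re z2 * q_re y)
         + 2 * c * q_re (z3 * y) - 2 * d * q_re (z4 * quat_conj y)).
Proof.
rewrite qtrZ; under [X in qtr X]eq_fun => q do
  rewrite mulrDl !mulrBl -!(mulrA (quat_real _)) -!(mulrA z2) -!(mulrA z4)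
    -!(mulrA q) -!(mulrA (quat_conj q)).
rewrite qtrD !qtrB !qtrZ qtr_mulr qtr_mid qtr_conjr qtr_conj_mid.
by ring.
Qed.

Lemma qtr_framer (a b c d e : R) (z1 z2 z3 z4 y : quat R) :
  qtr (fun q => quat_real e *
    (y * (quat_real a * (q * z1) - quat_real b * (z2 * q) -
      quat_real c * (quat_conj q * z3) + quat_real d * (z4 * quat_conj q))))
  = e * (4 * a * (q_re y * q_re z1) - 4 * b * q_re (y * z2)
         + 2 * c * q_re (y * quat_conj z3) - 2 * d * q_re (y * z4)).
Proof.
rewrite qtrZ; under [X in qtr X]eq_fun => q do
  rewrite mulrDr !mulrBr !(mulrA y (quat_real _)) -!(quat_realC _ y)
    -!(mulrA (quat_real _)) !(mulrA y z2) !(mulrA y z4).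
rewrite qtrD !qtrB !qtrZ qtr_mull qtr_mid qtr_conjl qtr_conj_mid.
by ring.
Qed.

Definition qunit (c : 'I_4) : quat R :=
  Quat (c == 0)%:R (c == 1)%:R (c == 2)%:R (c == 3)%:R.

Lemma qtrE (T : quat R -> quat R) :
  qtr T = \sum_c qdot (T (qunit c)) (qunit c).
Proof. by rewrite !big_ord_recl big_ord0 /qtr /qdot /qunit /=; ring. Qed.

Lemma quat_decomp (q : quat R) :
  q = \sum_c quat_real (qdot q (qunit c)) * qunit c.
Proof.
rewrite !big_ord_recl big_ord0 /qdot /qunit; case: q => a b c d.
by apply: quat_ext; rewrite !quatE /=; ring.
Qed.

(** For i = j the only entry is q - conj(q), twice the imaginary part of q. *)
Definition frame_mx (i j : 'I_n) (q : quat R) : qmx R n := \matrix_(r, s)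
  (quat_real ((r == i)%:R * (s == j)%:R) * q -
   quat_real ((r == j)%:R * (s == i)%:R) * quat_conj q).

Definition frame i j q : g := vsproj (sp_space R n) (frame_mx i j q).

Lemma frameE i j q r s : vsval (frame i j q) r s =
  quat_real ((r == i)%:R * (s == j)%:R) * q -
   quat_real ((r == j)%:R * (s == i)%:R) * quat_conj q.
Proof.
rewrite /frame vsprojK ?mxE //; apply: sp_mem_entry => {}r {}s; rewrite !mxE.
by apply: quat_ext; rewrite !quatE; ring.
Qed.

Lemma sp_sum_entry (I : Type) (w : seq I) (F : I -> g) r s :
  vsval (\sum_(i <- w) F i) r s = \sum_(i <- w) vsval (F i) r s.
Proof.
apply: (big_morph (fun X => vsval X r s)) => [X Y|] /=; by rewrite !mxE.
Qed.

(* The frame contains both F_ij(q) = q E_ij - conj(q) E_ji and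
   F_ji(- conj(q)), which are equal: hence the factor 1/2. *)
Lemma sp_vtrace (f : g -> g) : linear f -> vtrace f =
  2^-1 * \sum_i \sum_j qtr (fun q => vsval (f (frame i j q)) i j).
Proof.
move=> lf.
pose e (a : 'I_n * 'I_n * 'I_4) := frame a.1.1 a.1.2 (qunit a.2).
pose phi (a : 'I_n * 'I_n * 'I_4) X :=
  2^-1 * qdot (vsval X a.1.1 a.1.2) (qunit a.2).
rewrite (@vtrace_frame _ _ _ e phi) //.
- rewrite -(pair_bigA _ (fun p c => phi (p, c) (f (e (p, c))))) /=.
  rewrite -(pair_bigA _ (fun i j => \sum_c phi (i, j, c) (f (e (i, j, c))))).
  rewrite mulr_sumr; apply: eq_bigr => i _ /=.
  by rewrite mulr_sumr; apply: eq_bigr => j _; rewrite qtrE mulr_sumr.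
- by move=> a b X Y; rewrite /phi /= !mxE /qdot !quatE; ring.
move=> X; apply: sp_ext => r s; rewrite sp_sum_entry.
rewrite -(pair_bigA _ (fun p c => vsval (phi (p, c) X *: e (p, c)) r s)) /=.
rewrite -(pair_bigA _
  (fun i j => \sum_c vsval (phi (i, j, c) X *: e (i, j, c)) r s)) /=.
have inner i j : \sum_c vsval (phi (i, j, c) X *: e (i, j, c)) r s =
   quat_real ((r == i)%:R * ((s == j)%:R * 2^-1)) * vsval X i j -
   quat_real ((r == j)%:R * ((s == i)%:R * 2^-1)) * quat_conj (vsval X i j).
  rewrite [in RHS](quat_decomp (vsval X i j)) quat_conj_sum !mulr_sumr.
  rewrite -sumrB; apply: eq_bigr => c _; rewrite /= mxE frameE /phi /=.
  move: (vsval X i j) (qunit c) => x u.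
  by apply: quat_ext; rewrite !quatE; ring.
under eq_bigr do under eq_bigr do rewrite inner.
under eq_bigr do rewrite sumrB.
(* The double sum yields half of X_rs minus half of conj(X_sr), and these two contributions are
   equal. *)
rewrite sumrB quat_sum_delta2 exchange_big quat_sum_delta2 (sp_entry X s r).
by apply: quat_ext; rewrite !quatE; field.
Qed.

End Frame.

(** * The Ricci tensor of a diagonal metric and its Einstein equations *)

Section RicciFormula.
Variables (R : realType) (n : nat) (lam : 'I_n -> 'I_n -> R).
Hypothesis lam_gt0 : forall i j, 0 < lam i j.
Hypothesis lamC : forall i j, lam i j = lam j i.
Local Notation g := (sp R n).
Local Notation P := (lc_coef lam).
Local Notation D := (lc lam).
Implicit Types X Y Z : g.

Lemma lc_frame Z i j q r s : vsval (D (frame i j q) Z) r s =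
  quat_real ((r == i)%:R * P r j s) * (q * vsval Z j s)
  - quat_real ((s == j)%:R * P s i r) * (vsval Z r i * q)
  - quat_real ((r == j)%:R * P r i s) * (quat_conj q * vsval Z i s)
  + quat_real ((s == i)%:R * P s j r) * (vsval Z r j * quat_conj q).
Proof.
rewrite lcE //.
rewrite -(quat_sum_delta (fun k => (r == i)%:R * P r k s)
  (fun k => q * vsval Z k s)).
rewrite -(quat_sum_delta (fun k => (s == j)%:R * P s k r)
  (fun k => vsval Z r k * q)).
rewrite -(quat_sum_delta (fun k => (r == j)%:R * P r k s)
  (fun k => quat_conj q * vsval Z k s)).
rewrite -(quat_sum_delta (fun k => (s == i)%:R * P s k r)
  (fun k => vsval Z r k * quat_conj q)).
rewrite -!sumrB -big_split; apply: eq_bigr => k _; rewrite !frameE.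
move: (P r k s) (P s k r) (vsval Z k s) (vsval Z r k) => p p' z z'.
have El a b c (x y : quat R) : quat_real (a * (b * c)) * (x * y) =
    quat_real c * (quat_real (b * a) * x * y).
  rewrite -[quat_real (b * a) * x * y]mulrA [RHS]mulrA quat_realM.
  by congr (quat_real _ * _); ring.
have Er a b c (x y : quat R) : quat_real (a * (b * c)) * (x * y) =
    quat_real c * (x * (quat_real (a * b) * y)).
  by rewrite [a * b]mulrC [x * (quat_real _ * _)]mulrA -quat_realC El.
rewrite mulrBl !mulrBr opprB addrA addrAC [X in X + _]addrAC.
by rewrite !(El _ _ _ q) !(El _ _ _ (quat_conj q)) !(Er _ _ _ z').
Qed.

(** Each of the four terms of [lc_frame] contributes the real part of a diagonal entry of Z, which
    is zero. Since D_Z is skew, this expresses that sp(n) is unimodular. *)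
Lemma lc_trace Z : vtrace (D ^~ Z) = 0.
Proof.
rewrite sp_vtrace; last exact: lc_linl.
rewrite big1 ?mulr0 // => i _; rewrite big1 // => j _.
under [X in qtr X]eq_fun => q do rewrite lc_frame.
rewrite qtrD !qtrB !qtrZ qtr_mulr qtr_mull qtr_conjr qtr_conjl !sp_re_diag.
rewrite [j == i]eq_sym; have [->|_] := eqVneq i j.
  by rewrite sp_re_diag /=; ring.
by rewrite /=; ring.
Qed.

Let S Y Z i j := qdot (vsval Y i j) (vsval Z i j).

Lemma qdot_sp Y Z i j : q_re (vsval Y i j * vsval Z j i) = - S Y Z i j.
Proof. by rewrite (sp_entry Z i j) mulrN q_reN -qdotE. Qed.

Lemma qdot_spC Y Z i j : S Y Z i j = S Y Z j i.
Proof.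
by rewrite /S (sp_entry Z i j) (sp_entry Y i j) /qdot !quatE; ring.
Qed.

(** The trace is evaluated on the frame. Of the eight terms in each summand, two vanish because
    diagonal entries have zero real part, two give triple sums, and the four from the conjugate half
    of the frame carry a Kronecker delta. *)
Lemma lc2_trace Y Z : vtrace (fun X => D (D X Z) Y) =
  - (4 * (\sum_i \sum_j \sum_k P i k j * P i j k * S Z Y j k) +
     2 * \sum_i \sum_j P i i j * S Z Y i j).
Proof.
rewrite sp_vtrace; last first.
  by move=> a X X'; rewrite !(lc_linl _ _).
have Phalf i j : P i j i = 2^-1.
  have := lc_coefC lam_gt0 lamC i j i; lra.
pose T i j k := - 4 * (P i k j * P i j k * S Z Y j k)
  - 4 * (P j k i * P j i k * S Z Y i k)
  - (j == i)%:R * (2 * (P i k j * P i i k * S Z Y i k))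
  - (k == i)%:R * (2 * (P i k j * P k j i * S Z Y i j))
  - (k == j)%:R * (2 * (P j k i * P k i j * S Z Y i j))
  - (j == i)%:R * (2 * (P j k i * P j j k * S Z Y i k)).
have TE i j : qtr (fun q => vsval (D (D (frame i j q) Z) Y) i j) =
    \sum_k T i j k.
  under [X in qtr X]eq_fun => q do rewrite lcE //.
  rewrite qtr_sum; apply: eq_bigr => k _.
  under [X in qtr X]eq_fun => q do rewrite !lc_frame.
  rewrite qtrB qtr_framel qtr_framer /T !eqxx !sp_re_diag.
  rewrite !(mul1r (P _ _ _)).
  rewrite qdot_sp [q_re (vsval Y i k * vsval Z k i)]qdot_sp.
  rewrite [S Y Z i k]qdotC -/(S Z Y i k).
  (* Under its delta, each remaining real part becomes an inner product of entries of Z and Y in the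
     same position. *)
  have h1 : (i == j)%:R * q_re (vsval Z i k * vsval Y k j) =
      - ((j == i)%:R * S Z Y i k).
    rewrite eq_sym; case: eqVneq => [->|_]; rewrite ?mul1r ?mul0r ?oppr0 //.
    by rewrite qdot_sp.
  have h2 : (k == i)%:R * q_re (vsval Z i j * quat_conj (vsval Y k j)) =
      (k == i)%:R * S Z Y i j.
    by case: eqVneq => [->|_]; rewrite ?mul0r // -qdotE.
  have h3 : (k == j)%:R * q_re (vsval Y i k * quat_conj (vsval Z i j)) =
      (k == j)%:R * S Z Y i j.
    by case: eqVneq => [->|_]; rewrite ?mul0r // -qdotE qdotC.
  have h4 : (j == i)%:R * q_re (vsval Y i k * vsval Z k j) =
      - ((j == i)%:R * S Z Y i k).
    case: eqVneq => [->|_]; rewrite ?mul1r ?mul0r ?oppr0 //.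
    by rewrite qdot_sp [S Y Z i k]qdotC.
  apply/eqP; rewrite -subr_eq0; apply/eqP.
  transitivity (2 * P i k j * P i i k *
      ((i == j)%:R * q_re (vsval Z i k * vsval Y k j) +
       (j == i)%:R * S Z Y i k)
    - 2 * P i k j * P k j i *
      ((k == i)%:R * q_re (vsval Z i j * quat_conj (vsval Y k j)) -
       (k == i)%:R * S Z Y i j)
    - 2 * P j k i * P k i j *
      ((k == j)%:R * q_re (vsval Y i k * quat_conj (vsval Z i j)) -
       (k == j)%:R * S Z Y i j)
    + 2 * P j k i * P j j k *
      ((j == i)%:R * q_re (vsval Y i k * vsval Z k j) +
       (j == i)%:R * S Z Y i k)).
    by ring.
  by rewrite h1 h2 h3 h4; ring.
pose sum3 (f : 'I_n -> 'I_n -> 'I_n -> R) := \sum_i \sum_j \sum_k f i j k.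
have s3B f h : sum3 (fun i j k => f i j k - h i j k) = sum3 f - sum3 h.
  rewrite -sumrB; apply: eq_bigr => i _; rewrite -sumrB.
  by apply: eq_bigr => j _; rewrite -sumrB.
have s3Z a f : sum3 (fun i j k => a * f i j k) = a * sum3 f.
  rewrite mulr_sumr; apply: eq_bigr => i _; rewrite mulr_sumr.
  by apply: eq_bigr => j _; rewrite mulr_sumr.
have s3E f h : (forall i j k, f i j k = h i j k) -> sum3 f = sum3 h.
  by move=> fh; do 3!(apply: eq_bigr => ? _).
transitivity (2^-1 * sum3 T).
  by congr (_ * _); do 2!(apply: eq_bigr => ? _).
pose A := sum3 (fun i j k => P i k j * P i j k * S Z Y j k).
pose B := \sum_i \sum_j P i i j * S Z Y i j.
(* Exchanging i and j identifies the two triple sums. In the other four the delta removes one index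
   and leaves a factor P i j i = 1/2, so each of them equals [B]. *)
have e2 : sum3 (fun i j k => P j k i * P j i k * S Z Y i k) = A.
  by rewrite /sum3 exchange_big.
have e3 : sum3 (fun i j k =>
    (j == i)%:R * (2 * (P i k j * P i i k * S Z Y i k))) = B.
  apply: eq_bigr => i _; rewrite exchange_big; apply: eq_bigr => k _.
  rewrite (sum_delta (fun j => 2 * (P i k j * P i i k * S Z Y i k))) Phalf.
  by field.
have e4 : sum3 (fun i j k =>
    (k == i)%:R * (2 * (P i k j * P k j i * S Z Y i j))) = B.
  apply: eq_bigr => i _; apply: eq_bigr => j _.
  rewrite (sum_delta (fun k => 2 * (P i k j * P k j i * S Z Y i j))) Phalf.
  by field.
have e5 : sum3 (fun i j k =>
    (k == j)%:R * (2 * (P j k i * P k i j * S Z Y i j))) = B.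
  rewrite /sum3 exchange_big; apply: eq_bigr => j _; apply: eq_bigr => i _.
  rewrite (sum_delta (fun k => 2 * (P j k i * P k i j * S Z Y i j))) Phalf.
  by rewrite [S Z Y j i]qdot_spC mulrA mulrCA divff ?mulr1 ?pnatr_eq0.
have e6 : sum3 (fun i j k =>
    (j == i)%:R * (2 * (P j k i * P j j k * S Z Y i k))) = B.
  apply: eq_bigr => i _; rewrite exchange_big; apply: eq_bigr => k _.
  rewrite (sum_delta (fun j => 2 * (P j k i * P j j k * S Z Y i k))) Phalf.
  by field.
rewrite /T !s3B !s3Z e2 e3 e4 e5 e6.
rewrite -/(sum3 (fun i j k => P i k j * P i j k * S Z Y j k)) -/A -/B.
by field.
Qed.

(** Ricci tensor and metric are both combinations of the products [qdot] of entries of Y and Z in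
    the same position, so it suffices to compare coefficients. *)
Lemma lc_einstein c :
  (forall j k, 4 * (\sum_i P i k j * P i j k) + P j j k + P k k j =
    c * lam j k) ->
  einstein (sp_bracket R n) (metric lam_gt0).
Proof.
move=> ein; exists D; first exact: lc_levi_civita.
exists c => Y Z.
rewrite (ricci_trace (lc_levi_civita lam_gt0 lamC)); last first.
- exact: lc_trace.
- exact: lc_linr.
- exact: lc_linl.
rewrite lc2_trace // opprK metricE.
pose s j k := qdot (vsval Y j k) (vsval Z j k).
have sC j k : s j k = s k j by exact: qdot_spC.
transitivity (\sum_j \sum_k (4 * (\sum_i P i k j * P i j k) + P j j k + P k k j)
  * s j k); last first.
  rewrite mulr_sumr; apply: eq_bigr => j _; rewrite mulr_sumr.
  by apply: eq_bigr => k _; rewrite ein mulrA.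
(* As [s] is symmetric, one of the two copies may be summed with its indices exchanged, which makes
   the coefficients symmetric. *)
have -> : 2 * (\sum_i \sum_j P i i j * s i j) =
    \sum_j \sum_k P j j k * s j k + \sum_j \sum_k P k k j * s j k.
  rewrite mulr_natl mulr2n; congr (_ + _).
  rewrite [RHS]exchange_big; apply: eq_bigr => j _; apply: eq_bigr => k _.
  by rewrite sC.
rewrite exchange_big mulr_sumr -!big_split; apply: eq_bigr => j _.
rewrite exchange_big mulr_sumr -!big_split; apply: eq_bigr => k _.
by rewrite /= !mulrDl addrA -mulrA mulr_suml.
Qed.

End RicciFormula.

(** * A solution of the Einstein equations on Sp(4) *)

Section Sp4.
Variable R : realType.

Definition lam4 (u v x : R) (i j : 'I_4) : R :=
  if i == j :> nat then if i == 0 :> nat then v else u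
  else if (i == 0 :> nat) || (j == 0 :> nat) then 1 else x.

Lemma lam4C u v x i j : lam4 u v x i j = lam4 u v x j i.
Proof. by rewrite /lam4 eq_sym orbC; case: eqP => // ->. Qed.

Lemma lam4_gt0 u v x : 0 < u -> 0 < v -> 0 < x ->
  forall i j, 0 < lam4 u v x i j.
Proof. by move=> ? ? ? i j; rewrite /lam4; do ?case: ifP. Qed.

(** The four equations belong to the index pairs (0,0), (i,i), (0,i) and (i,j) with i, j > 0
    distinct; the symmetry of [lam4] reduces the sixteen pairs to these. *)
Lemma lam4_einstein u v x c (u_gt0 : 0 < u) (v_gt0 : 0 < v) (x_gt0 : 0 < x) :
  c * v = 3 * v ^+ 2 + 2 ->
  c * u = u ^+ 2 + 2 * (u / x) ^+ 2 + 2 ->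
  c = 10 - 3 / 2 * (u + v) - 2 * x ->
  c * x = 7 - 3 * (u / x) + x ^+ 2 ->
  einstein (sp_bracket R 4) (metric (lam4_gt0 u_gt0 v_gt0 x_gt0)).
Proof.
move=> Ev Eu E1 Ex.
have [un vn xn] : [/\ u != 0, v != 0 & x != 0] by split; rewrite gt_eqF.
apply: (@lc_einstein _ _ _ _ (@lam4C u v x) c) => j k.
rewrite !big_ord_recl big_ord0 /lc_coef.
case: j => [[|[|[|[|//]]]] jlt]; case: k => [[|[|[|[|//]]]] klt];
  by rewrite /lam4 /= ?Ev ?Eu ?Ex ?mulr1 ?E1; field; rewrite ?un ?vn ?xn.
Qed.

(** Put w = u / x. Substituting c from the last equation into the one for c u gives (w - 1) ((x^2 +
    5) w - 2) = 0. The second factor gives u = 2x / (x^2 + 5), and then c x = (x^4 + 12 x^2 + 29) /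
    (x^2 + 5). The inequalities serve to exclude natural reductivity. *)
Lemma einstein_params : exists u v x c : R,
  [/\ [/\ 0 < u, 0 < v & 0 < x], [/\ u != 1, u != x & x != 1],
    c * v = 3 * v ^+ 2 + 2,
    c * u = u ^+ 2 + 2 * (u / x) ^+ 2 + 2 &
    c = 10 - 3 / 2 * (u + v) - 2 * x /\ c * x = 7 - 3 * (u / x) + x ^+ 2].
Proof.
(* With d = x (x^2 + 5), the equation linear in v has the solution v = N(x) / (3 d). The equation
   for c v is what remains, and f(x) = 3 d^2 (3 v^2 + 2 - c v). *)
pose N (x : R) := - 6 * x ^+ 4 + 20 * x ^+ 3 - 50 * x ^+ 2 + 100 * x - 58.
pose f x := 6 * (x ^+ 3 + 5 * x) ^+ 2 + N x ^+ 2
  - (x ^+ 4 + 12 * x ^+ 2 + 29) * N x.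
have [p pE] : exists p : {poly R}, forall x, p.[x] = f x.
  pose q : {poly R} := - 6%:P * 'X^4 + 20%:P * 'X^3 - 50%:P * 'X^2
    + 100%:P * 'X - 58%:P.
  exists (6%:P * ('X^3 + 5%:P * 'X) ^+ 2 + q ^+ 2
    - ('X^4 + 12%:P * 'X^2 + 29%:P) * q) => x.
  by rewrite /q !(hornerD, hornerN, hornerM, horner_exp, hornerXn, hornerX,
    hornerC).
(* f is negative at 3/2 and positive at 8/5; on this interval N is positive, hence so is v. *)
have [x /andP[x1 x2] /rootP] : exists2 x, 3 / 2 <= x <= 8 / 5 & root p x.
  apply: poly_ivt; first by lra.
  by rewrite !pE /f /N; apply/andP; split; lra.
rewrite pE => fx; pose d := x * (x ^+ 2 + 5).
pose c := (x ^+ 4 + 12 * x ^+ 2 + 29) / d.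
have x_gt0 : 0 < x by lra.
have h_gt0 : 0 < x ^+ 2 + 5 by nra.
have N_gt0 : 0 < N x by rewrite /N; nra.
have [xn hn Nn] : [/\ x != 0, x ^+ 2 + 5 != 0 & N x != 0].
  by split; rewrite gt_eqF.
exists (2 * x / (x ^+ 2 + 5)), (N x / (3 * d)), x, c; split.
- by split; rewrite // divr_gt0 ?mulr_gt0.
- split; last by rewrite gt_eqF //; lra.
    by rewrite lt_eqF // ltr_pdivrMr // mul1r; nra.
  rewrite lt_eqF // ltr_pdivrMr //; nra.
- apply/eqP; rewrite -subr_eq0; apply/eqP.
  transitivity (- f x / (3 * d ^+ 2)).
    by rewrite /f /c /d; field; rewrite ?xn ?hn.
  by rewrite fx oppr0 mul0r.
- by rewrite /c /d; field; rewrite ?xn ?hn.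
by split; rewrite /c /d /N; field; rewrite ?xn ?hn.
Qed.

End Sp4.

(** * Invariance under the diagonal subgroup *)

Section AdInvariance.
Variables (R : realType) (n : nat) (lam : 'I_n -> 'I_n -> R).
Hypothesis lam_gt0 : forall i j, 0 < lam i j.

Lemma qdotMM (h k x y : quat R) :
  qdot (h * x * quat_conj k) (h * y * quat_conj k) =
  qdot h h * qdot x y * qdot k k.
Proof.
have ql (p a b : quat R) : qdot (p * a) (p * b) = qdot p p * qdot a b.
  by rewrite /qdot !quatE; ring.
have qr (p a b : quat R) : qdot (a * p) (b * p) = qdot a b * qdot p p.
  by rewrite /qdot !quatE; ring.
by rewrite qr ql; congr (_ * _); rewrite /qdot !quatE; ring.
Qed.

(** A diagonal h in Sp(n) has unit quaternions on its diagonal, and Ad(h) replaces X_rs by h_rr X_rs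
    conj(h_ss), which preserves the inner product of each entry separately. *)
Lemma metric_Ad_diag : Ad_invariant (diag_Sp1 R n) (metric lam_gt0).
Proof.
move=> h [Sph /is_diag_mxP hdiag] X Y; rewrite !metricE.
have hh i : qdot (h i i) (h i i) = 1.
  have /matrixP/(_ i i)/(congr1 (@q_re R)) := Sph.
  rewrite !mxE eqxx (bigD1 i) // big1 => [|j ji]; last first.
    by rewrite hdiag ?mulr0.
  by rewrite !mxE [X in q_re X = _]addr0 q_reMC -qdotE => ->.
have AdE Z r s : vsval (spAd h Z) r s = h r r * vsval Z r s * quat_conj (h s s).
  rewrite vsval_spAd mxE (bigD1 s) //= big1 ?addr0 => [|j js]; last first.
    by rewrite !mxE hdiag ?(eq_sym (s : nat)) ?quat_conj0 ?mulr0.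
  rewrite !mxE; congr (_ * _).
  rewrite (bigD1 r) //= big1 ?addr0 // => j jr.
  by rewrite hdiag ?mul0r // eq_sym.
apply: eq_bigr => r _; apply: eq_bigr => s _; congr (_ * _).
by rewrite !AdE qdotMM !hh mul1r mulr1.
Qed.

End AdInvariance.

(** * Naturally reductive metrics *)

Section WeakDerivative.
Variable R : realType.

Lemma is_derive_linear (U V W : normedModType R) (L : V -> W) (f : U -> V)
    a v df :
  linear L -> continuous L ->
  is_derive a v f df -> is_derive a v (L \o f) (L df).
Proof.
move=> lL cL [fd fdf].
pose LL := HB.pack_for {linear V -> W} L (GRing.isLinear.Build _ _ _ _ L lL).
have qf : (fun h => h^-1 *: ((f \o shift a) (h *: v) - f a)) @ 0^' --> df.
  by rewrite -fdf; exact: fd.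
have : (fun h => h^-1 *: ((L \o f \o shift a) (h *: v) - (L \o f) a)) @ 0^'
    --> L df.
  have -> : (fun h => h^-1 *: ((L \o f \o shift a) (h *: v) - (L \o f) a)) =
      L \o (fun h => h^-1 *: ((f \o shift a) (h *: v) - f a)).
    by apply/funext => h /=; rewrite -[RHS]/(LL _) linearZ (linearB LL).
  exact: (cvg_comp _ _ qf (cL df)).
move=> H; split; first by apply/cvg_ex; exists (L df).
exact: cvg_lim.
Qed.

(* The derivative at 0 tested on linear functionals: V carries no topology. *)
Definition curve_deriv (V : vectType R) (c : R -> V) (v : V) : Prop :=
  forall phi : V -> R, scalar phi ->
    is_derive (0 : R) (1 : R) (phi \o c) (phi v).

Lemma is_derive_finsum (W : normedModType R) (I : Type) (r : seq I)
    (f : I -> R -> W) (df : I -> W) :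
  (forall i, is_derive (0 : R) (1 : R) (f i) (df i)) ->
  is_derive (0 : R) (1 : R) (fun t => \sum_(i <- r) f i t) (\sum_(i <- r) df i).
Proof.
move=> H; elim: r => [|i r IH].
  rewrite big_nil (_ : (fun _ => _) = cst 0); first exact: is_derive_cst.
  by apply/funext => t; rewrite big_nil.
rewrite big_cons (_ : (fun _ => _) = f i \+ (fun t => \sum_(j <- r) f j t)).
  exact: is_deriveD.
by apply/funext => t; rewrite big_cons.
Qed.

Lemma vbasis_expand (V : vectType R) (X : V) :
  X = \sum_(i < \dim {:V}) coord (vbasis {:V}) i X *: (vbasis {:V})`_i.
Proof. by rewrite -coord_vbasis ?memvf. Qed.

(** Expanding [b] in bases reduces the Leibniz rule to finitely many products of real functions. *)
Lemma curve_deriv_bilinear (U V : vectType R) (b : U -> V -> R)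
    (c : R -> U) (d : R -> V) u v :
  (forall y, scalar (b ^~ y)) -> (forall x, scalar (b x)) ->
  curve_deriv c u -> curve_deriv d v ->
  is_derive (0 : R) (1 : R) (fun t => b (c t) (d t)) (b u (d 0) + b (c 0) v).
Proof.
move=> bl br cu dv.
have bE x y : b x y = \sum_(i < \dim {:U}) \sum_(j < \dim {:V})
    b (vbasis {:U})`_i (vbasis {:V})`_j *
    (coord (vbasis {:U}) i x * coord (vbasis {:V}) j y).
  pose L := HB.pack_for {scalar U} (b ^~ y)
    (GRing.isLinear.Build _ _ _ _ (b ^~ y) (bl y)).
  rewrite {1}[x]vbasis_expand -[b _ y]/(L _) linear_sum.
  apply: eq_bigr => i _; rewrite linearZ /=.
  pose L' := HB.pack_for {scalar V} (b (vbasis {:U})`_i)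
    (GRing.isLinear.Build _ _ _ _ (b (vbasis {:U})`_i) (br _)).
  rewrite {1}[y]vbasis_expand -[b _ _]/(L' _) linear_sum mulr_sumr.
  apply: eq_bigr => j _; rewrite linearZ /=; ring.
have -> : (fun t => b (c t) (d t)) = (fun t => 
   \sum_(i < \dim {:U}) \sum_(j < \dim {:V})
    b (vbasis {:U})`_i (vbasis {:V})`_j *
    (coord (vbasis {:U}) i (c t) * coord (vbasis {:V}) j (d t))).
  by apply/funext => t; rewrite bE.
rewrite !bE -big_split.
apply: is_derive_finsum => i; rewrite /= -big_split.
apply: is_derive_finsum => j /=; rewrite -mulrDr.
have ci := cu (coord (vbasis {:U}) i) (linearP _).
have dj := dv (coord (vbasis {:V}) j) (linearP _).
have H := is_deriveZ (b (vbasis {:U})`_i (vbasis {:V})`_j) (is_deriveM ci dj).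
rewrite (_ : _ * _ = b (vbasis {:U})`_i (vbasis {:V})`_j *:
   (coord (vbasis {:U}) i (c 0) *: coord (vbasis {:V}) j v +
    coord (vbasis {:V}) j (d 0) *: coord (vbasis {:U}) i u)); first exact: H.
by rewrite /GRing.scale /=; ring.
Qed.

Lemma curve_deriv_linear (U V : vectType R) (L : U -> V) c u :
  linear L -> curve_deriv c u -> curve_deriv (L \o c) (L u).
Proof.
move=> lL cu phi lphi; apply: (cu (phi \o L)) => a x y /=.
by rewrite lL lphi.
Qed.

End WeakDerivative.

(** * Derivatives of curves of quaternionic matrices *)

Section Curves.
Variables (R : realType) (n : nat).
Local Notation g := (sp R n).
Implicit Types (X Y Z W : g) (A B : qmx R n).

(** The matrix unit q E_ij. The factor 1 puts it in the form of [quat_sum_delta2]. *)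
Definition entry_mx (i j : 'I_n) (q : quat R) : qmx R n :=
  \matrix_(r, s) (quat_real ((r == i)%:R * ((s == j)%:R * 1)) * q).

Lemma qmx_decomp A : A = \sum_i \sum_j
  (q_re (A i j) *: entry_mx i j (Quat 1 0 0 0) +
   q_i (A i j) *: entry_mx i j (Quat 0 1 0 0) +
   q_j (A i j) *: entry_mx i j (Quat 0 0 1 0) +
   q_k (A i j) *: entry_mx i j (Quat 0 0 0 1)).
Proof.
apply/matrixP => r s.
transitivity (\sum_i \sum_j
    quat_real ((r == i)%:R * ((s == j)%:R * 1)) * A i j).
  by rewrite quat_sum_delta2 [RHS]mul1r.
have entry_sum (I : Type) (w : seq I) (F : I -> qmx R n) :
    (\sum_(i <- w) F i) r s = \sum_(i <- w) F i r s.
  by apply: (big_morph (fun X : qmx R n => X r s)) => [X Y|]; rewrite !mxE.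
rewrite entry_sum; apply: eq_bigr => i _; rewrite entry_sum.
apply: eq_bigr => j _; rewrite !mxE.
by apply: quat_ext; rewrite !quatE /=; ring.
Qed.

Lemma qmx_linear_decomp (V : lmodType R) (L : {linear qmx R n -> V}) A :
  L A = \sum_i \sum_j
    (q_re (A i j) *: L (entry_mx i j (Quat 1 0 0 0)) +
     q_i (A i j) *: L (entry_mx i j (Quat 0 1 0 0)) +
     q_j (A i j) *: L (entry_mx i j (Quat 0 0 1 0)) +
     q_k (A i j) *: L (entry_mx i j (Quat 0 0 0 1))).
Proof.
rewrite {1}[A]qmx_decomp linear_sum.
apply: eq_bigr => i _; rewrite linear_sum; apply: eq_bigr => j _.
by rewrite !linearD !linearZ.
Qed.

Lemma is_derive_qmx_entries (gamma : R -> qmx R n) A :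
  is_derive (0 : R) (1 : R) (fun t => qmx_coords (gamma t)) (qmx_coords A) ->
  forall i j,
  [/\ is_derive (0 : R) (1 : R) (fun t => q_re (gamma t i j)) (q_re (A i j)),
      is_derive (0 : R) (1 : R) (fun t => q_i (gamma t i j)) (q_i (A i j)),
      is_derive (0 : R) (1 : R) (fun t => q_j (gamma t i j)) (q_j (A i j)) &
      is_derive (0 : R) (1 : R) (fun t => q_k (gamma t i j)) (q_k (A i j))].
Proof.
move=> dg i j.
pose T := ('M[R]_n * 'M[R]_n * 'M[R]_n * 'M[R]_n)%type.
have fc (U V W : normedModType R) (p : U -> V) (q : V -> W) :
    continuous p -> continuous q -> continuous (q \o p).
  by move=> cp cq x; exact: (cvg_comp _ _ (cp x) (cq _)).
have coord_d (c : quat R -> R) (p : T -> 'M[R]_n) : linear p -> continuous p ->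
    (forall B, p (qmx_coords B) = map_mx c B) ->
    is_derive (0 : R) (1 : R) (fun t => c (gamma t i j)) (c (A i j)).
  move=> lp cp pE.
  have lM : linear (fun M : T => p M i j) by move=> a M N; rewrite lp !mxE.
  have cM : continuous (fun M : T => p M i j).
    exact: (fc _ _ _ p (fun N : 'M[R]_n => N i j : R) cp
      (@coord_continuous R n n i j)).
  have := is_derive_linear lM cM dg.
  rewrite (_ : _ \o _ = fun t => c (gamma t i j)) ?pE ?mxE //.
  by apply/funext => t /=; rewrite pE mxE.
have cfst (U V : normedModType R) : continuous (@fst U V).
  by move=> x; exact: cvg_fst.
have csnd (U V : normedModType R) : continuous (@snd U V).
  by move=> x; exact: cvg_snd.
split.
- apply: (coord_d _ (fst \o (fst \o fst))) => //.
  exact: (fc _ _ _ _ _ (fc _ _ _ _ _ (cfst _ _) (cfst _ _)) (cfst _ _)).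
- apply: (coord_d _ (snd \o (fst \o fst))) => //.
  exact: (fc _ _ _ _ _ (fc _ _ _ _ _ (cfst _ _) (cfst _ _)) (csnd _ _)).
- apply: (coord_d _ (snd \o fst)) => //.
  exact: (fc _ _ _ _ _ (cfst _ _) (csnd _ _)).
- by apply: (coord_d _ snd) => //; exact: csnd.
Qed.

(** Both sides amount to differentiability of the real components of the entries: linear
    functionals, and [qmx_coords] itself, are finite combinations of these with constant
    coefficients. *)
Lemma curve_deriv_qmx (gamma : R -> qmx R n) A :
  is_derive (0 : R) (1 : R) (fun t => qmx_coords (gamma t)) (qmx_coords A) <->
  curve_deriv gamma A.
Proof.
have scale_d (W : normedModType R) (f : R -> R) df (w : W) :
    is_derive (0 : R) (1 : R) f df ->
    is_derive (0 : R) (1 : R) (fun t => f t *: w) (df *: w).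
  move=> fd; apply: (is_derive_linear _ (@scalel_continuous _ _ w) fd).
  by move=> a x y; rewrite scalerDl scalerA.
split.
  move=> /is_derive_qmx_entries dg phi lphi.
  pose L := HB.pack_for {scalar qmx R n} phi
    (GRing.isLinear.Build _ _ _ _ phi lphi).
  have LE B : phi B = \sum_i \sum_j
      (q_re (B i j) *: phi (entry_mx i j (Quat 1 0 0 0)) +
       q_i (B i j) *: phi (entry_mx i j (Quat 0 1 0 0)) +
       q_j (B i j) *: phi (entry_mx i j (Quat 0 0 1 0)) +
       q_k (B i j) *: phi (entry_mx i j (Quat 0 0 0 1))).
    exact: (qmx_linear_decomp L).
  rewrite LE (_ : phi \o gamma = fun t => phi (gamma t)) //.
  under [X in is_derive _ _ X]eq_fun => t do rewrite LE.
  apply: is_derive_finsum => i; apply: is_derive_finsum => j.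
  have [d1 d2 d3 d4] := dg i j.
  exact: (is_deriveD (is_deriveD (is_deriveD (scale_d _ _ _ _ d1)
    (scale_d _ _ _ _ d2)) (scale_d _ _ _ _ d3)) (scale_d _ _ _ _ d4)).
move=> cg.
have LE B : qmx_coords B = \sum_i \sum_j
      (q_re (B i j) *: qmx_coords (entry_mx i j (Quat 1 0 0 0)) +
       q_i (B i j) *: qmx_coords (entry_mx i j (Quat 0 1 0 0)) +
       q_j (B i j) *: qmx_coords (entry_mx i j (Quat 0 0 1 0)) +
       q_k (B i j) *: qmx_coords (entry_mx i j (Quat 0 0 0 1))).
  exact: (qmx_linear_decomp (@qmx_coords R n)).
rewrite LE; under [X in is_derive _ _ X]eq_fun => t do rewrite LE.
apply: is_derive_finsum => i; apply: is_derive_finsum => j.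
have d1 :
    is_derive (0 : R) (1 : R) (fun t => q_re (gamma t i j)) (q_re (A i j)).
  by apply: (cg (fun B => q_re (B i j))) => a B C; rewrite !mxE !quatE; ring.
have d2 : is_derive (0 : R) (1 : R) (fun t => q_i (gamma t i j)) (q_i (A i j)).
  by apply: (cg (fun B => q_i (B i j))) => a B C; rewrite !mxE !quatE; ring.
have d3 : is_derive (0 : R) (1 : R) (fun t => q_j (gamma t i j)) (q_j (A i j)).
  by apply: (cg (fun B => q_j (B i j))) => a B C; rewrite !mxE !quatE; ring.
have d4 : is_derive (0 : R) (1 : R) (fun t => q_k (gamma t i j)) (q_k (A i j)).
  by apply: (cg (fun B => q_k (B i j))) => a B C; rewrite !mxE !quatE; ring.
exact: (is_deriveD (is_deriveD (is_deriveD (scale_d _ _ _ _ d1)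
  (scale_d _ _ _ _ d2)) (scale_d _ _ _ _ d3)) (scale_d _ _ _ _ d4)).
Qed.

End Curves.

(** * The Lie algebra of a closed subgroup *)

Section LieAlgebra.
Variables (R : realType) (n : nat).
Local Notation g := (sp R n).
Implicit Types (X Y Z W : g) (A B C : qmx R n).

Lemma qmx_scalemxAl a A B : (a *: A) *m B = a *: (A *m B : qmx R n) :> qmx R n.
Proof.
apply/matrixP => i j; rewrite !mxE mulr_sumr; apply: eq_bigr => k _.
by rewrite !mxE mulrA.
Qed.

Lemma qmx_scalemxAr a A B : A *m (a *: B) = a *: (A *m B : qmx R n) :> qmx R n.
Proof.
apply/matrixP => i j; rewrite !mxE mulr_sumr; apply: eq_bigr => k _.
by rewrite !mxE mulrA -quat_realC mulrA.
Qed.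

Lemma qmx_mulmxDl A B C :
  (A + B) *m C = (A *m C : qmx R n) + (B *m C) :> qmx R n.
Proof. exact: mulmxDl. Qed.

Lemma qmx_mulmxDr A B C :
  A *m (B + C) = (A *m B : qmx R n) + (A *m C) :> qmx R n.
Proof. exact: mulmxDr. Qed.

Lemma qadj_sp X : qadj (vsval X) = - vsval X.
Proof. by have := subvsP X; rewrite mem_sp_space => /eqP. Qed.

Lemma qadj1 : qadj (1%:M : qmx R n) = 1%:M.
Proof.
apply/matrixP => i j; rewrite !mxE eq_sym; case: eqVneq => _.
  by apply: quat_ext; rewrite !quatE ?oppr0.
by rewrite quat_conj0.
Qed.

(** Ad(gamma(t)) X is bilinear in gamma(t) and its adjoint, and W is skew-Hermitian, so the Leibniz
    rule gives W X - X W. *)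
Lemma Ad_curve_deriv (gamma : R -> qmx R n) X W : gamma 0 = 1%:M ->
  curve_deriv gamma (vsval W) ->
  curve_deriv (fun t => spAd (gamma t) X) (sp_bracket R n W X).
Proof.
move=> g0 dg phi lphi.
pose L := HB.pack_for {scalar g} phi (GRing.isLinear.Build _ _ _ _ phi lphi).
pose b A B := L (vsproj (sp_space R n) (A *m vsval X *m qadj B)).
have bl B : scalar (b ^~ B).
  move=> a A C; rewrite /b qmx_mulmxDl qmx_scalemxAl.
  by rewrite qmx_mulmxDl qmx_scalemxAl !linearP.
have br A : scalar (b A).
  by move=> a B C; rewrite /b linearP qmx_mulmxDr qmx_scalemxAr !linearP.
have := curve_deriv_bilinear bl br dg dg; rewrite g0.
have -> // : b (vsval W) 1%:M + b 1%:M (vsval W) = phi (sp_bracket R n W X).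
rewrite /b -!linearD; congr phi; rewrite qadj1 mulmx1 mul1mx qadj_sp.
by rewrite qmulmxN.
Qed.

Variables (K : set (qmx R n)) (k : {vspace g}).
Hypotheses (subK : closed_subgroup K) (lieK : is_lie_algebra_of K k).

Lemma lie_curve X : X \in k -> exists2 gamma : R -> qmx R n,
  (forall t, K (gamma t)) /\ gamma 0 = 1%:M & curve_deriv gamma (vsval X).
Proof.
move=> /lieK [gamma [Kg gD dg]]; exists gamma; last exact/curve_deriv_qmx.
split=> //; have := closed_subgroup_sub subK (Kg 0) => /= sp0.
(* gamma(0) is idempotent and has its adjoint as inverse, hence is the identity. *)
by rewrite -[LHS]mul1mx -sp0 -mulmxA -gD addr0.
Qed.

(** The constant function t |-> m (Ad(gamma(t)) X) (Ad(gamma(t)) Y) is differentiated at 0. *)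
Lemma lie_skew (m : inner_product g) W : Ad_invariant K m -> W \in k ->
  forall X Y, m (sp_bracket R n W X) Y + m X (sp_bracket R n W Y) = 0.
Proof.
move=> inv /lie_curve [gamma [Kg g0] dg] X Y.
have Ad1 Z : spAd (gamma 0) Z = Z.
  by apply/val_inj; rewrite -[LHS]/(vsval _) vsval_spAd g0 qadj1 mulmx1 mul1mx.
have ml y : scalar (m ^~ y) by move=> a x z; rewrite linearPl.
have mr x : scalar (m x) by move=> a y z; rewrite linearPr.
have := curve_deriv_bilinear ml mr
  (Ad_curve_deriv X g0 dg) (Ad_curve_deriv Y g0 dg).
rewrite !Ad1 (_ : (fun t => _) = cst (m X Y)); last first.
  by apply/funext => t; rewrite inv.
move=> [_ <-]; have [_ ->] := is_derive_cst (m X Y) (0 : R) (1 : R).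
by [].
Qed.

(** Conjugating by A the one-parameter subgroup of Y gives one in K with velocity Ad(A) Y. *)
Lemma lie_Ad A Y : K A -> Y \in k -> spAd A Y \in k.
Proof.
move=> KA /lieK [delta [Kd dD dd]]; apply/lieK.
exists (fun t => A *m delta t *m qadj A); split.
- move=> t; apply: (closed_subgroupM subK).
    exact: (closed_subgroupM subK).
  exact: (closed_subgroupV subK).
- move=> s t; rewrite dD -!mulmxA; congr (A *m (_ *m _)).
  have spA := closed_subgroup_sub subK KA.
  by rewrite !mulmxA -[qadj A *m A]/(_) spA mul1mx.
apply/curve_deriv_qmx; rewrite vsval_spAd.
have lA : linear (fun B : qmx R n => A *m B *m qadj A : qmx R n).
  move=> a B C; rewrite qmx_mulmxDr qmx_scalemxAr.
  by rewrite qmx_mulmxDl qmx_scalemxAl.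
apply: (curve_deriv_linear lA); exact/curve_deriv_qmx.
Qed.

Lemma lie_bracket X Y : X \in k -> Y \in k -> sp_bracket R n X Y \in k.
Proof.
move=> /lie_curve [gamma [Kg g0] dg] Yk.
set W := sp_bracket R n X Y.
suff : W - projv k W = 0.
  by move/eqP; rewrite subr_eq0 => /eqP ->; exact: memv_proj.
rewrite [LHS]vbasis_expand big1 // => i _.
(* The curve Ad(gamma(t)) Y stays in [k]. Since derivatives are tested on functionals, membership of
   its velocity in [k] is checked with functionals that vanish on [k]. *)
pose phi Z := coord (vbasis {:g}) i (Z - projv k Z).
have lphi : scalar phi.
  by move=> a x y; rewrite /phi linearP opprD addrACA -scalerBr linearP.
have := Ad_curve_deriv Y g0 dg lphi.
rewrite (_ : _ \o _ = cst 0); last first.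
  by apply/funext => t /=; rewrite /phi projv_id ?lie_Ad // subrr linear0.
move=> [_]; have [_ ->] := is_derive_cst (0 : R) (0 : R) (1 : R).
by rewrite -/W -/(phi W) => <-; rewrite scale0r.
Qed.

End LieAlgebra.

(** * An algebraic consequence of natural reductivity *)

Section NaturallyReductive.
Variables (R : realType) (n : nat).
Local Notation g := (sp R n).
Local Notation br := (sp_bracket R n).
Implicit Types (X Y Z W : g).

Lemma sp_bracketDl X Y Z : br (X + Y) Z = br X Z + br Y Z.
Proof.
apply/val_inj; rewrite -[LHS]/(vsval _) -[RHS]/(vsval _).
rewrite linearD /= !vsval_sp_bracket /= qmx_mulmxDl qmx_mulmxDr.
by rewrite opprD addrACA.
Qed.

Lemma sp_bracketDr X Y Z : br X (Y + Z) = br X Y + br X Z.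
Proof.
apply/val_inj; rewrite -[LHS]/(vsval _) -[RHS]/(vsval _).
rewrite linearD /= !vsval_sp_bracket /= qmx_mulmxDl qmx_mulmxDr.
by rewrite opprD addrACA.
Qed.

Lemma mem_prod_alg (k : {vspace g}) (U : g * g) :
  (U \in prod_alg k) = (U.2 \in k).
Proof. by rewrite -memv_preim lfunE. Qed.

(* The complement p is the graph {(X + C X, C X)} of some C : sp(n) -> k. *)
Lemma naturally_reductive_identity (K : set (qmx R n)) (k : {vspace g})
    (m : inner_product g) :
  closed_subgroup K -> is_lie_algebra_of K k -> naturally_reductive_wrt K k m ->
  forall X Y Z, exists CY CZ : g, [/\ CY \in k, CZ \in k &
    m (br X Y + br X CY) Z + m Y (br X Z + br X CZ) = 0].
Proof.
move=> subK lieK [inv [p]] /=; set h := isotropy_alg k => -[[ph0 phT] _ nr].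
have h_diag U : U \in h -> orbit_diff U = 0.
  by move=> /memv_imgP[W _ ->]; rewrite lfunE /orbit_diff subrr.
(* The p-component of (X, 0) represents the tangent vector X, because [orbit_diff] vanishes on the
   isotropy algebra. *)
have lift X : exists2 U, U \in p & U.2 \in k /\ U.1 = X + U.2.
  have : (X, 0) \in (p + h)%VS by rewrite phT mem_prod_alg mem0v.
  move=> /memv_addP[U Up [V Vh XE]]; exists U => //; split.
    rewrite -mem_prod_alg -phT.
    exact: (subvP (addvSl p h)).
  have := h_diag V Vh; rewrite /orbit_diff => /eqP.
  rewrite subr_eq0 => /eqP V12.
  have E1 : X = U.1 + V.1 := congr1 fst XE.
  have E2 : 0 = U.2 + V.2 := congr1 snd XE.
  by rewrite E1 -addrA V12 [V.2 + _]addrC -E2 addr0.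
have proj U V : U \in p -> V \in p ->
    orbit_diff (daddv_pi p h (pair_bracket U V)) =
    orbit_diff (pair_bracket U V).
  move=> Up Vp.
  have kp (W : g * g) : W \in p -> W.2 \in k.
    by move=> Wp; rewrite -mem_prod_alg -phT; exact: (subvP (addvSl p h)).
  have mem : pair_bracket U V \in (p + h)%VS.
    by rewrite phT mem_prod_alg; apply: (lie_bracket subK lieK); exact: kp.
  have hp0 : (h :&: p = 0)%VS by rewrite capvC.
  have := h_diag _ (memv_pi h p (pair_bracket U V)).
  rewrite -{3}(daddv_pi_add ph0 mem) /orbit_diff /= => H.
  by rewrite opprD addrACA H addr0.
move=> X Y Z.
have [U Up [Uk UX]] := lift X; have [V Vp [Vk VY]] := lift Y.
have [W Wp [Wk WZ]] := lift Z.
exists V.2, W.2; split=> //.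
have := nr U V W Up Vp Wp; rewrite !proj //.
have od (T : g * g) T' : T.1 = T' + T.2 -> orbit_diff T = T'.
  by rewrite /orbit_diff => ->; rewrite addrK.
rewrite (od _ _ VY) (od _ _ WZ) /orbit_diff /= UX VY WZ.
rewrite !sp_bracketDl !sp_bracketDr !addrA !addrK.
(* The first arguments leave [U.2, Y] and [U.2, Z], whose contributions cancel because U.2 in [k]
   acts by skew maps. *)
have := lie_skew subK lieK inv Uk Y Z.
rewrite [X in X = 0 -> _ = 0 -> _]addrC !linearDl !linearDr /=.
move=> /eqP; rewrite addr_eq0 => /eqP ->.
move=> <-; ring.
Qed.

End NaturallyReductive.

(** * A criterion for diagonal metrics not to be naturally reductive *)

Section DiagonalMetrics.
Variables (R : realType) (n : nat) (lam : 'I_n -> 'I_n -> R).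
Hypothesis lam_gt0 : forall i j, 0 < lam i j.
Hypothesis lamC : forall i j, lam i j = lam j i.
Local Notation g := (sp R n).
Local Notation br := (sp_bracket R n).
Local Notation m := (metric lam_gt0).
Implicit Types (X Y Z W : g).

Lemma metricC X Y : m X Y = m Y X.
Proof. by rewrite hermC /= expr0 mul1r. Qed.

(** Pairing with a frame element extracts a single entry of X. The factor 2 comes from the positions
    (i,j) and (j,i), and for i = j from the doubled imaginary part. *)
Lemma metric_frame X i j q :
  m X (frame i j q) = 2 * lam i j * qdot (vsval X i j) q.
Proof.
have delta2 (F : 'I_n -> 'I_n -> R) a b :
    \sum_r \sum_s (r == a)%:R * ((s == b)%:R * F r s) = F a b.
  under eq_bigr do rewrite -mulr_sumr sum_delta.
  by rewrite sum_delta.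
transitivity (\sum_r \sum_s (r == i)%:R * ((s == j)%:R *
      (lam r s * qdot (vsval X r s) q)) -
    \sum_r \sum_s (r == j)%:R * ((s == i)%:R *
      (lam r s * qdot (vsval X r s) (quat_conj q)))).
  rewrite metricE -sumrB; apply: eq_bigr => r _; rewrite -sumrB.
  apply: eq_bigr => s _; rewrite frameE.
  move: (vsval X r s) => x; rewrite /qdot !quatE; ring.
rewrite !delta2 (lamC j i) (sp_entry X i j).
by move: (vsval X i j) => x; rewrite /qdot !quatE; ring.
Qed.

Lemma bracket_frame X i j q r s : vsval (br X (frame i j q)) r s =
  quat_real (s == j)%:R * (vsval X r i * q)
  - quat_real (s == i)%:R * (vsval X r j * quat_conj q)
  - quat_real (r == i)%:R * (q * vsval X j s)
  + quat_real (r == j)%:R * (quat_conj q * vsval X i s).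
Proof.
rewrite vsval_sp_bracket.
have -> : (vsval X *m vsval (frame i j q) - vsval (frame i j q) *m vsval X) r s
    = \sum_k (vsval X r k * vsval (frame i j q) k s
              - vsval (frame i j q) r k * vsval X k s).
  by rewrite sumrB !mxE.
rewrite -(quat_sum_delta (fun=> (s == j)%:R) (fun k => vsval X r k * q)).
rewrite -(quat_sum_delta (fun=> (s == i)%:R)
  (fun k => vsval X r k * quat_conj q)).
rewrite -(quat_sum_delta (fun=> (r == i)%:R) (fun k => q * vsval X k s)).
rewrite -(quat_sum_delta (fun=> (r == j)%:R)
  (fun k => quat_conj q * vsval X k s)).
rewrite -!sumrB -big_split; apply: eq_bigr => k _; rewrite !frameE.
move: (vsval X r k) (vsval X k s) => x y.
rewrite mulrBl mulrBr opprB addrA addrAC.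
rewrite -!mulrA ![x * (quat_real _ * _)]mulrA -!(quat_realC _ x) -!mulrA.
by rewrite ![(r == _)%:R * _]mulrC.
Qed.

Definition is_diag_sp W := forall i j, i != j -> vsval W i j = 0.

(** Testing skewness on F_ii(q) and F_ij(q W_ij) with q = i yields (lam_ii - lam_ij) |W_ij|^2 = 0.
    If only lam_jj differs, the same argument applies to W_ji. *)
Lemma skew_is_diag W :
  (forall i j, i != j -> lam i i != lam i j \/ lam j j != lam j i) ->
  (forall X Y, m (br W X) Y + m X (br W Y) = 0) -> is_diag_sp W.
Proof.
move=> gap skew.
have key i j : i != j -> lam i i != lam i j -> vsval W i j = 0.
  move=> ij lij; pose q : quat R := Quat 0 1 0 0.
  have := skew (frame i i q) (frame i j (q * vsval W i j)).
  rewrite (metricC (frame i i q)) !metric_frame.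
  have -> : vsval (br W (frame i i q)) i j =
      quat_conj q * vsval W i j - q * vsval W i j.
    rewrite bracket_frame (eq_sym j) (negbTE ij) eqxx quat_real_false.
    by rewrite quat_real_true !mul0r subrr sub0r !mul1r addrC.
  have -> : vsval (br W (frame i j (q * vsval W i j))) i i =
      q * vsval W i j * quat_conj (vsval W i j) -
      vsval W i j * quat_conj (q * vsval W i j).
    rewrite bracket_frame eqxx (negbTE ij) quat_real_false quat_real_true.
    rewrite !mul0r sub0r !mul1r addr0 (sp_entry W i j) mulrN opprK.
    by rewrite addrC.
  have := @qdot_eq0 _ (vsval W i j); move: (vsval W i j) => w w0 H.
  apply: w0; apply/eqP; have : (lam i i - lam i j) * qdot w w = 0.
    rewrite -[RHS](mulr0 4^-1) -H; case: w {H} => w1 w2 w3 w4.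
    by rewrite /qdot !quatE /=; field.
  by move/eqP; rewrite mulf_eq0 subr_eq0 (negbTE lij).
move=> i j ij; have [/key ->//|lj] := gap i j ij.
have ji : j != i by rewrite eq_sym.
by rewrite (sp_entry W j i) (key j i ji lj) quat_conj0 oppr0.
Qed.

(** For diagonal W the entry is X_ij W_jj - W_ii X_ij. *)
Lemma bracket_diag X W i j : is_diag_sp W -> vsval X i j = 0 ->
  vsval (br X W) i j = 0.
Proof.
move=> dW Xij; rewrite vsval_sp_bracket.
have -> : (vsval X *m vsval W - vsval W *m vsval X) i j
    = \sum_k (vsval X i k * vsval W k j - vsval W i k * vsval X k j).
  by rewrite sumrB !mxE.
rewrite big1 // => k _.
have -> : vsval X i k * vsval W k j = 0.
  by have [->|kj] := eqVneq k j; rewrite ?Xij ?mul0r // dW // mulr0.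
have -> : vsval W i k * vsval X k j = 0.
  by have [<-|ik] := eqVneq i k; rewrite ?Xij ?mulr0 // dW // mul0r.
by rewrite subrr.
Qed.

(** For X = F_ab(1), Y = F_bc(1), Z = F_ac(1), the bracket [X, Y] has entry 1 at (a,c) and [X, Z]
    has entry -1 at (b,c). The unknown elements of [k] are diagonal and do not contribute at these
    positions, so the identity would read 2 lam_ac - 2 lam_bc = 0. *)
Lemma not_naturally_reductive a b c :
  (forall i j, i != j -> lam i i != lam i j \/ lam j j != lam j i) ->
  a != b -> b != c -> a != c -> lam a c != lam b c ->
  ~ naturally_reductive m.
Proof.
move=> gap ab bc ac lacbc [K [k [subK lieK nr]]].
have diag W : W \in k -> is_diag_sp W.
  by move=> Wk; apply: skew_is_diag => //; exact: (lie_skew subK lieK nr.1 Wk).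
pose X : g := frame a b 1.
have [CY [CZ [CYk CZk]]] := naturally_reductive_identity subK lieK nr X
  (frame b c 1) (frame a c 1).
have q0 := @quat_real_false R; have q1 := @quat_real_true R.
have XE r s : vsval X r s = quat_real ((r == a) && (s == b))%:R
    - quat_real ((r == b) && (s == a))%:R.
  by rewrite frameE -!mulnb !natrM; apply: quat_ext; rewrite !quatE; ring.
have Xac : vsval X a c = 0.
  by rewrite XE (eq_sym c) (negbTE bc) (eq_sym c) (negbTE ac) !andbF q0 subr0.
have Xbc : vsval X b c = 0.
  by rewrite XE (eq_sym c) (negbTE bc) (eq_sym c) (negbTE ac) !andbF q0 subr0.
have Xab : vsval X a b = 1 by rewrite XE !eqxx (negbTE ab) q0 q1 subr0.
have Xba : vsval X b a = - 1.
  by rewrite XE !eqxx (eq_sym b) (negbTE ab) q0 q1 sub0r.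
have br_ac : vsval (br X (frame b c 1)) a c = 1.
  rewrite bracket_frame eqxx (eq_sym c) (negbTE bc) (negbTE ab) (negbTE ac).
  by rewrite q0 q1 !mul0r !subr0 addr0 mul1r mulr1.
have br_bc : vsval (br X (frame a c 1)) b c = - 1.
  rewrite bracket_frame eqxx (eq_sym c) (negbTE ac) (eq_sym b) (negbTE ab).
  by rewrite (negbTE bc) q0 q1 !mul0r !subr0 addr0 mul1r mulr1.
have addE (Y Z : g) r s : vsval (Y + Z) r s = vsval Y r s + vsval Z r s.
  by rewrite /= mxE.
rewrite (metricC (frame b c 1)) !metric_frame !addE br_ac br_bc.
rewrite (bracket_diag (diag _ CYk) Xac) (bracket_diag (diag _ CZk) Xbc) !addr0.
have -> : qdot (1 : quat R) 1 = 1 by rewrite /qdot !quatE; ring.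
have -> : qdot (- 1 : quat R) 1 = - 1 by rewrite /qdot !quatE; ring.
by move=> H; case/eqP: lacbc; lra.
Qed.

End DiagonalMetrics.

Theorem theorem1p2 (R : realType) :
  exists g : inner_product (sp R 4),
    einstein (sp_bracket R 4) g /\
    Ad_invariant (diag_Sp1 R 4) g /\
    ~ naturally_reductive g.
Proof.
have [u [v [x [c [[u0 v0 x0] [u1 ux x1] Ev Eu [Ec Ex]]]]]] := einstein_params R.
exists (metric (lam4_gt0 u0 v0 x0)); split.
  exact: lam4_einstein Ev Eu Ec Ex.
split; first exact: metric_Ad_diag.
(* Here lam_01 = 1 and lam_21 = x differ. The gap condition follows from u != 1 for pairs containing
   0, taken at the other index, and from u != x for the remaining pairs. *)
apply: (@not_naturally_reductive _ _ _ _ (@lam4C R u v x) 0 2 1) => //.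
  case=> [[|[|[|[|//]]]] ilt]; case=> [[|[|[|[|//]]]] jlt] //= _;
    rewrite /lam4 /=; by [left|right].
by rewrite /lam4 /= eq_sym.
Qed.
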